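(* Let $q$ be a prime, $a,h\in\mathbb{F}_q^{\times}$, let $M,N\leqslant q/2$ be positive integers and let $\bm{\alpha}=(\alpha_m)_{m\sim M}$, $\bm{\beta}=(\beta_n)_{n\sim N}$ be arbitrary complex weights. Then $$|W_{a,q}(\bm{\alpha},\bm{\beta};h,M,N)|\leqslant \|\bm{\alpha}\|_2\|\bm{\beta}\|_\infty^{1/3}\|\bm{\beta}\|_1^{2/3}\,q^{1/8+o(1)}M^{7/24}N^{1/8}\left(\frac{M^{7/48}}{q^{1/16}}+1\right)\left(\frac{N^{7/48}}{q^{1/16}}+1\right)$$ and $$|W_{a,q}(\bm{\alpha},\bm{\beta};h,M,N)|\leqslant \|\bm{\alpha}\|_2\|\bm{\beta}\|_1^{3/4}\|\bm{\beta}\|_\infty^{1/4}\,q^{1/8+o(1)}M^{5/16}N^{1/16}\left(\frac{M^{3/16}}{q^{1/8}}+1\right)\left(\frac{N^{3/16}}{q^{1/8}}+1\right),$$ where $o(1)$ denotes a quantity tending to $0$ as $q\to\infty$, uniformly in the other parameters.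
   Context: $a\sim A$ means $A\leqslant a<2A$. $\mathbf{e}_q(\xi)=\exp(2\pi i\xi/q)$; $\mathbb{F}_q$ is identified with $\{0,\dots,q-1\}$. For weights $\bm{\alpha}=(\alpha_m)_{m\sim M}$: $\|\bm{\alpha}\|_\infty=\max_{m\sim M}|\alpha_m|$ and $\|\bm{\alpha}\|_\sigma=(\sum_{m\sim M}|\alpha_m|^\sigma)^{1/\sigma}$, similarly for $\bm{\beta}$. The bilinear form is $$W_{a,q}(\bm{\alpha},\bm{\beta};h,M,N)=\sum_{m\sim M}\sum_{n\sim N}\alpha_m\beta_n\sum_{\substack{x\in\mathbb{F}_q\\ x^2=amn}}\mathbf{e}_q(hx).$$ *)

(* Defs.v *)
From HB Require Import structures.
From mathcomp Require Import all_boot all_order all_algebra.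
From mathcomp Require Import all_classical all_reals all_analysis.
From mathcomp Require Import complex.
Set Implicit Arguments. Unset Strict Implicit. Unset Printing Implicit Defensive.
Import Order.TTheory GRing.Theory Num.Theory.
Local Open Scope ring_scope.

(* e_q(k) = exp(2 pi i k / q), for k a natural number (elements of F_q are
   identified with {0,...,q-1}; e_q is q-periodic anyway). *)
Definition eq_add (R : realType) (q k : nat) : R[i] :=
  Complex (cos (2 * pi * k%:R / q%:R)) (sin (2 * pi * k%:R / q%:R)).

(* W_{a,q}(alpha,beta;h,M,N) with m ~ M meaning M <= m < 2M, and the inner sum over
   x in F_q = {0,..,q-1} with x^2 = a m n in F_q. *)
Definition Wsum (R : realType) (q a h M N : nat) (alpha beta : nat -> R[i]) : R[i] :=
  \sum_(M <= m < 2 * M) \sum_(N <= n < 2 * N)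
     alpha m * beta n *
     \sum_(x < q | (x ^ 2 == a * m * n %[mod q])%N) eq_add R q (h * x).

Definition cabs (R : realType) (z : R[i]) : R := let: Complex x y := z in Num.sqrt (x ^+ 2 + y ^+ 2).

Definition normInf (R : realType) (K : nat) (w : nat -> R[i]) : R :=
  \big[Num.max/0]_(K <= k < 2 * K) cabs (w k).

Definition normL (R : realType) (sigma : R) (K : nat) (w : nat -> R[i]) : R :=
  powR (\sum_(K <= k < 2 * K) powR (cabs (w k)) sigma) sigma^-1.

(* Main.v *)
Require Import Defs.
From HB Require Import structures.
From mathcomp Require Import all_boot all_order all_algebra.
From mathcomp Require Import all_classical all_reals all_analysis.
From mathcomp Require Import complex ring lra zify.
Import Order.TTheory GRing.Theory Num.Theory.
Import numFieldNormedType.Exports.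
Local Open Scope classical_set_scope.
Local Open Scope ring_scope.
Set Implicit Arguments. Unset Strict Implicit. Unset Printing Implicit Defensive.

(** Writing x = u v / j, where j runs over representatives of the two square classes,
    turns W into bilinear forms with kernel psi(h u v / j), where u and v run over the
    modular square roots of the intervals [M, 2M) and [N, 2N) scaled by j a and j.
    Cauchy-Schwarz in u and Hoelder in the pairs (v, v') reduce the problem to
    moments of r(w), the number of representations of w <> 0 as a difference of two
    such roots with K = M or N: the second bound needs sup r and sum r^2, the first
    one sum r^4.

    If x - y = w with x^2 = b n and y^2 = b m, then n is a quadratic polynomial in
    s = n - m with leading coefficient b / (4 w^2).  A Fejer kernel, Weyl
    differencing and the divisor bound give r(w) << K^2 / q + K^(1/2).  On the other
    hand two solutions (s, n + m) and (s', n' + m') satisfy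
    (b / (2 w^2)) (s^2 - s'^2) = (n + m) - (n' + m'), so r(w)^2 is controlled by the
    number of points of a lattice of determinant q in a box of sides K^2 and 2 K.
    That number is << K^3 / q unless the lattice has a short vector (z, y), and a
    given short vector occurs for at most two w; summing over short vectors gives
    sum r^4 << K^2 (K^3 / q)^(3/2) + K^3.  All implied constants are products
    of a divisor bound and a harmonic sum. *)

(** * Cauchy-Schwarz inequalities *)

(** For a fixed root u <> 0 of j a m, the map v -> u v / j is a bijection from the roots of j n to
    those of a m n. Summing over u counts the term (m, n) as often as j a m has roots, and these
    multiplicities add up to 2 over the two classes: 2 W is a sum of two bilinear forms.

    Off the diagonal, the sum over u is an exponential sum at k (v - v'). Its fourth moment is q
    times the energy sum r^2 of the roots attached to M, so this energy enters both bounds; the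
    roots attached to N enter through sup r or sum r^4. For the first bound the energy is
    interpolated between sum r << K^2 and sum r^4.

    The obstacle in sum r^4 is the generic lattice count K^3 / q: summed over all q values of w, its
    square is too large. But where it dominates, r << (K^3 / q)^(1/2), so r^4 << (K^3 / q)^(3/2) r,
    and sum r << K^2 applies.

    Numerical constants are absorbed by forcing the divisor bound to be at least 100, and o(1) is
    defined so that q^o(1) is exactly the square of the loss. *)

Section CauchySchwarz.
Variables (F : realFieldType) (I : finType) (P : pred I).
Implicit Types w f g : I -> F.

(** Lagrange's identity: the right side minus the left is half the double sum of
    [w i * w j * (f i * g j - f j * g i) ^+ 2]. *)
Lemma weighted_CS w f g : (forall i, P i -> 0 <= w i) ->
  (\sum_(i | P i) w i * f i * g i) ^+ 2 <=
  (\sum_(i | P i) w i * f i ^+ 2) * (\sum_(i | P i) w i * g i ^+ 2).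
Proof.
move=> w0.
have dbl a b : (\sum_(i | P i) a i) * (\sum_(i | P i) b i) =
    \sum_(i | P i) \sum_(j | P j) a i * b j :> F.
  by rewrite mulr_suml; apply: eq_bigr => i _; rewrite mulr_sumr.
rewrite expr2 !dbl.
suff H : 0 <= \sum_(i | P i) \sum_(j | P j) w i * w j * (f i * g j - f j * g i) ^+ 2.
  have E : \sum_(i | P i) \sum_(j | P j) w i * w j * (f i * g j - f j * g i) ^+ 2 =
      2 * (\sum_(i | P i) \sum_(j | P j) w i * f i ^+ 2 * (w j * g j ^+ 2)
      - \sum_(i | P i) \sum_(j | P j) w i * f i * g i * (w j * f j * g j)).
    rewrite mulrBr {1}(_ : 2 = 1 + 1) // mulrDl !mul1r.
    rewrite [X in _ = _ + X - _]exchange_big /= -big_split /= -mulNr mulr_sumr -big_split /=.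
    apply: eq_bigr => i _; rewrite -big_split /= mulr_sumr -big_split /=.
    by apply: eq_bigr => j _; ring.
  by rewrite E pmulr_rge0 // subr_ge0 in H.
by apply: sumr_ge0 => i Pi; apply: sumr_ge0 => j Pj; rewrite mulr_ge0 ?sqr_ge0 // mulr_ge0 ?w0.
Qed.

Lemma sum_CS f g :
  (\sum_(i | P i) f i * g i) ^+ 2 <=
  (\sum_(i | P i) f i ^+ 2) * (\sum_(i | P i) g i ^+ 2).
Proof.
have := @weighted_CS (fun=> 1) f g (fun _ _ => ler01).
by under eq_bigr do rewrite mul1r; under [X in _ <= X * _ -> _]eq_bigr do rewrite mul1r;
  under [X in _ <= _ * X -> _]eq_bigr do rewrite mul1r.
Qed.

(** Hoelder with exponents 4/3 and 4 for the measure [w]: Cauchy-Schwarz for [f] against 1, and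
    again for [f ^+ 2] against 1. *)
Lemma weighted_power4 w f : (forall i, P i -> 0 <= w i) ->
  (\sum_(i | P i) w i * f i) ^+ 4 <=
  (\sum_(i | P i) w i) ^+ 3 * \sum_(i | P i) w i * f i ^+ 4.
Proof.
move=> w0.
have W0 : 0 <= \sum_(i | P i) w i by apply: sumr_ge0.
have H1 := @weighted_CS w (fun=> 1) f w0.
have H2 := @weighted_CS w (fun=> 1) (fun i => f i ^+ 2) w0.
move: H1; under [X in X ^+ 2 <= _ -> _]eq_bigr do rewrite mulr1; under [X in _ <= X * _ -> _]eq_bigr do
  rewrite expr1n mulr1; move=> H1.
move: H2; under [X in X ^+ 2 <= _ -> _]eq_bigr do rewrite mulr1; under [X in _ <= X * _ -> _]eq_bigr do
  rewrite expr1n mulr1; under [X in _ <= _ * X -> _]eq_bigr do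
  rewrite -exprM; move=> H2.
rewrite (exprM _ 2 2); apply: le_trans (lerXn2r 2 _ _ H1) _; rewrite ?nnegrE ?sqr_ge0 //.
  by rewrite mulr_ge0 // sumr_ge0 // => i Pi; rewrite mulr_ge0 ?sqr_ge0 ?w0.
by rewrite exprMn (exprSr _ 2) -mulrA ler_wpM2l ?sqr_ge0.
Qed.

(* Two applications of Cauchy-Schwarz and a cancellation replace Hoelder's inequality. *)
Lemma weighted_power3 w f : (forall i, P i -> 0 <= w i) ->
    (forall i, P i -> 0 <= f i) ->
  (\sum_(i | P i) w i * f i) ^+ 3 <=
  (\sum_(i | P i) w i) ^+ 2 * \sum_(i | P i) w i * f i ^+ 3.
Proof.
move=> w0 f0.
have W0 : 0 <= \sum_(i | P i) w i by apply: sumr_ge0.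
have S0 k : 0 <= \sum_(i | P i) w i * f i ^+ k.
  by apply: sumr_ge0 => i Pi; rewrite mulr_ge0 ?w0 ?exprn_ge0 ?f0.
have := S0 1; under eq_bigr do rewrite expr1; rewrite le_eqVlt => /orP[/eqP <-|Sgt].
  by rewrite expr0n mulr_ge0 ?sqr_ge0 ?S0.
have wf i : P i -> 0 <= w i * f i by move=> Pi; rewrite mulr_ge0 ?w0 ?f0.
have H1 := @weighted_CS w (fun=> 1) f w0.
have H2 := @weighted_CS (fun i => w i * f i) (fun=> 1) f wf.
move: H1; under [X in X ^+ 2 <= _ -> _]eq_bigr do rewrite mulr1; under [X in _ <= X * _ -> _]eq_bigr do
  rewrite expr1n mulr1; move=> H1.
move: H2; under [X in X ^+ 2 <= _ -> _]eq_bigr do rewrite mulr1 -mulrA -expr2; under [X in _ <= X * _ -> _]eq_bigr do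
  rewrite expr1n mulr1; under [X in _ <= _ * X -> _]eq_bigr do
  rewrite -mulrA -exprS; move=> H2.
rewrite -(ler_pM2l Sgt) -exprS (exprM _ 2 2).
apply: le_trans (lerXn2r 2 _ _ H1) _; rewrite ?nnegrE ?sqr_ge0 // ?mulr_ge0 //.
by rewrite exprMn [X in _ <= X]mulrCA ler_wpM2l ?sqr_ge0.
Qed.

(** The cubic inequality with [f] as its own weight. It converts a fourth moment bound into an
    energy bound, the first moment being known. *)
Lemma sum_sqr_interpolation f : (forall i, P i -> 0 <= f i) ->
  (\sum_(i | P i) f i ^+ 2) ^+ 3 <=
  (\sum_(i | P i) f i) ^+ 2 * \sum_(i | P i) f i ^+ 4.
Proof.
move=> f0; have := @weighted_power3 f f f0 f0.
under eq_bigr do rewrite -expr2.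
by under [X in _ <= _ * X -> _]eq_bigr do rewrite -exprS.
Qed.

(** Hoelder with exponents 4 and 4/3, from the factorization [f g^3 = (f g) (g^2)] and a second
    Cauchy-Schwarz for [f^2 g^2]. *)
Lemma mixed_power4 f g : (forall i, P i -> 0 <= f i) -> (forall i, P i -> 0 <= g i) ->
  (\sum_(i | P i) f i * g i ^+ 3) ^+ 4 <=
  (\sum_(i | P i) f i ^+ 4) * (\sum_(i | P i) g i ^+ 4) ^+ 3.
Proof.
move=> f0 g0.
have S0 k l : 0 <= \sum_(i | P i) f i ^+ k * g i ^+ l.
  by apply: sumr_ge0 => i Pi; rewrite mulr_ge0 ?exprn_ge0 ?f0 ?g0.
have G0 : 0 <= \sum_(i | P i) g i ^+ 4 by apply: sumr_ge0 => i Pi; rewrite exprn_ge0 ?g0.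
have H1 := @sum_CS (fun i => f i * g i) (fun i => g i ^+ 2).
have H2 := @sum_CS (fun i => f i ^+ 2) (fun i => g i ^+ 2).
move: H1; under [X in X ^+ 2 <= _ -> _]eq_bigr do rewrite -mulrA -exprS; under [X in _ <= X * _ -> _]eq_bigr do
  rewrite exprMn; under [X in _ <= _ * X -> _]eq_bigr do rewrite -exprM; move=> H1.
move: H2; under [X in _ <= X * _ -> _]eq_bigr do rewrite -exprM;
  under [X in _ <= _ * X -> _]eq_bigr do rewrite -exprM; move=> H2.
rewrite (exprM _ 2 2).
apply: le_trans (lerXn2r 2 _ _ H1) _; rewrite ?nnegrE ?sqr_ge0 // ?mulr_ge0 //.
by rewrite exprMn (exprS _ 2) mulrA ler_wpM2r ?sqr_ge0.
Qed.

End CauchySchwarz.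

(** * The divisor bound *)

Section DivisorBound.
Local Open Scope nat_scope.

Lemma size_divisors_partn p n : prime p -> (0 < n)%N ->
  (size (divisors n) <= (logn p n).+1 * size (divisors n`_p^'))%N.
Proof.
move=> p_pr n0.
rewrite -(size_iota 0 (logn p n).+1) -(size_allpairs (fun i e => p ^ i * e)%N).
apply: uniq_leq_size; first exact: divisors_uniq.
move=> d; rewrite -dvdn_divisors // => dn.
have d0 : (0 < d)%N by apply: dvdn_gt0 dn.
rewrite -(partnC p d0) p_part.
apply/allpairsP; exists (logn p d, d`_p^'); split=> //=.
  by rewrite (mem_iota 0 (logn p n).+1) ltnS dvdn_leq_log.
by rewrite -dvdn_divisors ?part_gt0 // partn_dvd.
Qed.

(** With integer quotients, [a + 1 <= k (a / k + 1) <= k 2^(a / k)]. This serves small primes in the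
    divisor bound and, later, powers of a logarithm. *)
Lemma expn_succ_le k a : (0 < k)%N -> (a.+1 ^ k <= k ^ k * 2 ^ a)%N.
Proof.
move=> k0; apply: (@leq_trans ((k * 2 ^ (a %/ k)) ^ k)).
  rewrite leq_exp2r //; apply: (@leq_trans (k * (a %/ k).+1)).
    by rewrite mulnC ltn_ceil.
  by rewrite leq_mul2l ltn_expl ?orbT.
by rewrite expnMn leq_mul2l -expnM leq_exp2l ?leq_trunc_div ?orbT.
Qed.

(** A prime power [p^e] contributes [(e + 1)^k]. If [p >= 2 ^ k] this is at most [(2^e)^k <= p^e],
    with no loss; each of the finitely many smaller primes costs a factor [k ^ k]. The claim
    [smooth] treats the small primes, and a strong induction strips the large ones. *)
Lemma divisor_bound k : exists2 C, (0 < C)%N &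
  forall n, (0 < n)%N -> (size (divisors n) ^ k <= C * n)%N.
Proof.
case: k => [|k']; first by exists 1%N => // n n0; rewrite expn0 mul1n.
set k := k'.+1.
have smooth B : exists2 C, (0 < C)%N & forall n, (0 < n)%N ->
    (forall p, prime p -> p %| n -> p < B)%N -> (size (divisors n) ^ k <= C * n)%N.
  elim: B => [|B [C C0 IH]].
    exists 1%N => // n n0 sm; case: (ltnP 1 n) => n1; last first.
      by have -> : n = 1%N; [lia|rewrite exp1n].
    by have /(_ (pdiv_prime n1) (pdiv_dvd n)) := sm (pdiv n).
  exists (C * k ^ k)%N => [|n n0 sm]; first by rewrite muln_gt0 C0 expn_gt0.
  case Bpr: (prime B); last first.
    apply: (@leq_trans (C * n)); last by rewrite leq_mul2r leq_pmulr ?orbT // expn_gt0.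
    apply: IH => // p ppr pn; have := sm p ppr pn; rewrite ltnS leq_eqVlt.
    by case/orP=> // /eqP pB; rewrite -pB ppr in Bpr.
  have d0 : (0 < n`_B^')%N by rewrite part_gt0.
  apply: (@leq_trans (((logn B n).+1 * size (divisors n`_B^')) ^ k)).
    by rewrite leq_exp2r ?size_divisors_partn.
  rewrite expnMn; apply: (@leq_trans ((k ^ k * 2 ^ logn B n) * (C * n`_B^'))).
    apply: leq_mul; first exact: expn_succ_le.
    apply: IH => // p ppr pn; have := sm p ppr (dvdn_trans pn (dvdn_part _ _)).
    rewrite ltnS leq_eqVlt; case/orP=> // /eqP pB.
    have := part_pnat B^' n; move/pnatP => /(_ d0 _ ppr pn).
    by rewrite pB !inE eqxx.
  rewrite [X in (_ <= _ * X)%N](_ : _ = B ^ logn B n * n`_B^')%N; last first.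
    by rewrite -p_part partnC.
  rewrite [X in (X <= _)%N](_ : _ = (C * k ^ k) * (2 ^ logn B n * n`_B^'))%N; last by lia.
  rewrite leq_mul2l leq_mul2r; have [->|a0] := posnP (logn B n); first by rewrite !orbT.
  by rewrite leq_exp2r ?prime_gt1 ?orbT.
have [C C0 HC] := smooth (2 ^ k)%N; exists C => // n.
elim/ltn_ind: n => n IH n0.
have [/allP sm | /allPn[p]] := boolP (all (fun p => p < 2 ^ k)%N (primes n)).
  by apply: HC => // p ppr pn; apply: sm; rewrite mem_primes ppr n0.
rewrite mem_primes -leqNgt => /and3P[ppr _ pn] big.
have d0 : (0 < n`_p^')%N by rewrite part_gt0.
have e : n = (p ^ logn p n * n`_p^')%N by rewrite -p_part partnC.
have a0 : (0 < logn p n)%N by rewrite logn_gt0 mem_primes ppr n0.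
apply: (@leq_trans (((logn p n).+1 * size (divisors n`_p^')) ^ k)).
  by rewrite leq_exp2r ?size_divisors_partn.
rewrite expnMn [X in (_ <= _ * X)%N]e mulnCA leq_mul //.
  apply: (@leq_trans ((2 ^ logn p n) ^ k)); first by rewrite leq_exp2r // ltn_expl.
  by rewrite -expnM mulnC expnM leq_exp2r.
apply: IH => //; rewrite [X in (_ < X)%N]e ltn_Pmull //.
by rewrite -(exp1n (logn p n)) ltn_exp2r // prime_gt1.
Qed.

End DivisorBound.

(** * Additive characters modulo a prime *)

Section ComplexModulus.
Variable R : realType.
Implicit Types (z : R[i]) (x : R).
Local Notation conj := (@conjc R).

Lemma cabs_ge0 z : 0 <= cabs z.
Proof. by case: z => x y; exact: sqrtr_ge0. Qed.

Lemma cabs0 : cabs (0 : R[i]) = 0.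
Proof. by rewrite /cabs /= expr0n addr0 sqrtr0. Qed.

Lemma cabsM z1 z2 : cabs (z1 * z2) = cabs z1 * cabs z2.
Proof. exact: (ComplexField.Normc.normcM z1 z2). Qed.

Lemma cabsD z1 z2 : cabs (z1 + z2) <= cabs z1 + cabs z2.
Proof. exact: (complex.le_normcD z1 z2). Qed.

Lemma cabsN z : cabs (- z) = cabs z.
Proof. exact: (complex.normcN z). Qed.

Lemma cabsJ z : cabs (conj z) = cabs z.
Proof. by case: z => x y; rewrite /cabs /= sqrrN. Qed.

Lemma conjM z1 z2 : conj (z1 * z2) = conj z1 * conj z2.
Proof. exact: (rmorphM (@conjc R)). Qed.

Lemma conj_sum (I : Type) (r : seq I) (P : pred I) (f : I -> R[i]) :
  conj (\sum_(i <- r | P i) f i) = \sum_(i <- r | P i) conj (f i).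
Proof. exact: (rmorph_sum (@conjc R)). Qed.

Lemma cabs_real x : 0 <= x -> cabs (real_complex R x) = x.
Proof. by move=> x0; rewrite /cabs /= expr0n addr0 sqrtr_sqr ger0_norm. Qed.

Lemma cabs_sqr z : real_complex R (cabs z ^+ 2) = z * conj z.
Proof.
case: z => x y; rewrite /cabs sqr_sqrtr ?addr_ge0 ?sqr_ge0 //.
by rewrite /real_complex_def; congr Complex; ring.
Qed.

Lemma cabs_geRe z : complex.Re z <= cabs z.
Proof.
case: z => x y /=; apply: (le_trans (ler_norm x)).
by rewrite -sqrtr_sqr ler_wsqrtr // lerDl sqr_ge0.
Qed.

Lemma cabs_sum (I : Type) (r : seq I) (P : pred I) (f : I -> R[i]) :
  cabs (\sum_(i <- r | P i) f i) <= \sum_(i <- r | P i) cabs (f i).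
Proof.
elim/big_ind2: _ => //; first by rewrite cabs0.
by move=> x1 x2 y1 y2 h1 h2; apply: le_trans (cabsD _ _) (lerD h1 h2).
Qed.

End ComplexModulus.

(** * Characters of the prime field: distance from 1, geometric sums, orthogonality *)

Section AdditiveCharacter.
Variables (R : realType) (q : nat).
Hypothesis q_pr : prime q.
Local Notation F := ('F_q).
Local Notation e := (eq_add R q).
Local Notation conj := (@conjc R).

Let qR_gt0 : 0 < q%:R :> R. Proof. by rewrite ltr0n prime_gt0. Qed.

Lemma eq_addD m n : e (m + n) = e m * e n.
Proof.
rewrite /eq_add natrD mulrDr mulrDl cosD sinD.
by congr Complex; ring.
Qed.

Lemma eq_add0 : e 0 = 1.
Proof. by rewrite /eq_add mulr0 mul0r cos0 sin0. Qed.

Lemma eq_add_q : e q = 1.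
Proof.
rewrite /eq_add -mulrA divff ?gt_eqF // mulr1 mulr_natl.
by rewrite cos2pi sin2pi.
Qed.

Lemma eq_addMq k : e (k * q) = 1.
Proof. by elim: k => [|k IH]; rewrite ?mul0n ?eq_add0 // mulSn eq_addD eq_add_q mul1r. Qed.

Lemma eq_add_mod n : e (n %% q)%N = e n.
Proof. by rewrite [in RHS](divn_eq n q) eq_addD eq_addMq mul1r. Qed.

Lemma cabs_eq_add n : cabs (e n) = 1.
Proof. by rewrite /cabs /eq_add cos2Dsin2 sqrtr1. Qed.

Definition addchar (x : F) : R[i] := e (x : nat).
Local Notation psi := addchar.
Arguments addchar : simpl never.

Lemma addchar_nat n : psi n%:R = e n.
Proof. by rewrite /psi val_Fp_nat // eq_add_mod. Qed.

Lemma addcharD x y : psi (x + y) = psi x * psi y.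
Proof. by rewrite -(natr_Zp x) -(natr_Zp y) -natrD !addchar_nat eq_addD. Qed.

Lemma addchar0 : psi 0 = 1.
Proof. exact: eq_add0. Qed.

Lemma cabs_addchar x : cabs (psi x) = 1.
Proof. exact: cabs_eq_add. Qed.

Lemma conj_addchar x : conj (psi x) = psi (- x).
Proof.
have h : psi x * conj (psi x) = 1 by rewrite -cabs_sqr cabs_addchar expr1n.
have h2 : psi (- x) * psi x = 1 by rewrite -addcharD addNr addchar0.
by rewrite -[RHS]mulr1 -h mulrA h2 mul1r.
Qed.

Lemma addcharMn x n : psi (x *+ n) = psi x ^+ n.
Proof. by elim: n => [|n IH]; rewrite ?addchar0 // mulrS addcharD IH exprS. Qed.

Lemma cabs_1Bexp (z : R[i]) n : cabs z = 1 -> cabs (1 - z ^+ n) <= n%:R * cabs (1 - z).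
Proof.
move=> z1; rewrite -{1}(expr1n _ n) subrXX cabsM mulrC ler_wpM2r ?cabs_ge0 //.
apply: le_trans (cabs_sum _ _ _) _; rewrite (eq_bigr (fun=> 1)) => [|i _].
  by rewrite sumr_const card_ord.
rewrite expr1n mul1r; elim: (i : nat) => [|k IH]; first by rewrite /cabs /= expr1n expr0n addr0 sqrtr1.
by rewrite exprS cabsM IH z1 mulr1.
Qed.

(** The angle lies in [pi/2, 3 pi/2], where the cosine is nonpositive, so the real part of [1 - e n]
    is already at least 1. *)
Lemma cabs_1Beq_add_ge1 n : (q <= 4 * n)%N -> (4 * n <= 3 * q)%N -> 1 <= cabs (1 - e n).
Proof.
move=> h1 h2; apply: le_trans (cabs_geRe _); rewrite /= lerBrDr gerDl.
set t := _ / _; have -> : t = (t - pi) + pi by rewrite subrK.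
rewrite cosDpi oppr_le0 cos_ge0_pihalf //.
have E : t = pi * (2 * n%:R / q%:R) by rewrite /t; ring.
have p0 := @pi_gt0 R.
have h1' : 1 / 2 <= 2 * n%:R / q%:R :> R.
  by rewrite ler_pdivlMr // ; move: h1; rewrite -(ler_nat R) natrM; lra.
have h2' : 2 * n%:R / q%:R <= 3 / 2 :> R.
  by rewrite ler_pdivrMr // ; move: h2; rewrite -(ler_nat R) !natrM; lra.
rewrite E; apply/andP; split; nra.
Qed.

(* A multiple k y of y lies in [q/4, q/2], where psi is far from 1, and
   |1 - psi(k y)| <= k |1 - psi(y)|. *)
Lemma cabs_1Beq_add_ge n : (0 < n)%N -> (2 * n <= q)%N ->
  2 * n%:R / q%:R <= cabs (1 - e n).
Proof.
move=> n0 nq.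
suff [k [k0 h1 h2]] : exists k, [/\ (0 < k)%N, (q <= 4 * (k * n))%N & (2 * (k * n) <= q)%N].
  have := @cabs_1Bexp (e n) k (cabs_eq_add n).
  have -> : e n ^+ k = e (k * n).
    by elim: k {k0 h1 h2} => [|k IH]; rewrite ?eq_add0 // mulSn eq_addD exprS IH.
  have H1 := @cabs_1Beq_add_ge1 (k * n) h1 ltac:(lia).
  move/(le_trans H1) => H; rewrite ler_pdivrMr //.
  move: h2; rewrite -(ler_nat R) !natrM => h2.
  have k0' : 0 < k%:R :> R by rewrite ltr0n.
  have n0' : 0 < n%:R :> R by rewrite ltr0n.
  have c0 := cabs_ge0 (1 - e n); set c := cabs _ in H c0 *.
  apply: (@le_trans _ _ (2 * n%:R * (k%:R * c))); first by rewrite ler_peMr // mulr_ge0 // ltW.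
  by apply: (le_trans _ (ler_wpM2l c0 h2)); rewrite le_eqVlt; apply/orP; left; apply/eqP; ring.
case: (leqP q (4 * n)) => h; first by exists 1%N; split=> //; lia.
(* The first multiple of [n] beyond [q / 4]; it overshoots by at most [n < q / 4], hence stays below
   [q / 2]. *)
exists ((q %/ (4 * n)).+1)%N.
have := divn_eq q (4 * n); have := ltn_pmod q (_ : 0 < 4 * n)%N.
have : (0 < q %/ (4 * n))%N by rewrite divn_gt0; lia.
by set d := (q %/ _)%N; set m := (q %% _)%N => d0 /(_ ltac:(lia)) hm hq; split; nia.
Qed.

(** Comparable to the inverse distance of [y / q] to the nearest integer. A sum of two terms, rather
    than a maximum, makes the total over [y <> 0] twice a harmonic sum. *)
Definition geom_bound (y : F) : R := q%:R / (y : nat)%:R + q%:R / (q - y)%:R.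

Lemma geom_bound_ge0 y : 0 <= geom_bound y.
Proof. by rewrite addr_ge0 // divr_ge0. Qed.

Lemma ltn_Fp (y : F) : (y < q)%N.
Proof. by rewrite -[X in (_ < X)%N](card_Fp q_pr) card_ord ltn_ord. Qed.

Lemma Fp_gt0 (y : F) : y != 0 -> (0 < y)%N.
Proof. by move=> y0; rewrite lt0n; apply: contra y0 => /eqP y0; apply/eqP/val_inj. Qed.

Lemma cabs_1Baddchar y : y != 0 -> 2 <= geom_bound y * cabs (1 - psi y).
Proof.
move=> y0; have yq := ltn_Fp y; have y0' := Fp_gt0 y0.
case: (leqP (2 * y) q) => h.
  have := cabs_1Beq_add_ge y0' h; rewrite -/(psi y).
  have yR : 0 < (y : nat)%:R :> R by rewrite ltr0n.
  have c0 := cabs_ge0 (1 - psi y).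
  rewrite ler_pdivrMr // => H; rewrite /geom_bound [X in _ <= X]mulrDl.
  apply: (@le_trans _ _ (q%:R / (y : nat)%:R * cabs (1 - psi y))).
    by rewrite mulrAC ler_pdivlMr // (le_trans H) // mulrC.
  by rewrite lerDl mulr_ge0 // divr_ge0.
have E : psi (- y) = e (q - y).
  rewrite -addchar_nat natrB ?(ltnW yq) // natr_Zp pchar_Fp_0 // sub0r.
  by [].
have yqR : 0 < (q - y)%:R :> R by rewrite ltr0n subn_gt0.
have := @cabs_1Beq_add_ge (q - y) ltac:(lia) ltac:(lia); rewrite -E.
have -> : cabs (1 - psi (- y)) = cabs (1 - psi y).
  by rewrite -conj_addchar -(conjc1 R) -rmorphB cabsJ conjc1.
have c0 := cabs_ge0 (1 - psi y).
rewrite ler_pdivrMr // => H; rewrite /geom_bound [X in _ <= X]mulrDl.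
apply: (@le_trans _ _ (q%:R / (q - y)%:R * cabs (1 - psi y))).
  by rewrite mulrAC ler_pdivlMr // (le_trans H) // mulrC.
by rewrite lerDr mulr_ge0 // divr_ge0.
Qed.

Lemma addchar_neq1 y : y != 0 -> psi y != 1.
Proof.
move=> y0; apply/eqP => E; have := cabs_1Baddchar y0.
by rewrite E subrr cabs0 mulr0; lra.
Qed.

Lemma cabs_geometric_sum y n : y != 0 ->
  cabs (\sum_(i < n) psi (y *+ i)) <= geom_bound y.
Proof.
move=> y0; have d0 : 0 < cabs (1 - psi y).
  rewrite lt_neqAle cabs_ge0 andbT eq_sym; apply/eqP => E.
  by have := cabs_1Baddchar y0; rewrite E mulr0; lra.
rewrite -(ler_pM2r d0); apply: le_trans (cabs_1Baddchar y0).
rewrite -cabsM mulrC; under eq_bigr do rewrite addcharMn.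
have -> : (1 - psi y) * (\sum_(i < n) psi y ^+ i) = 1 - psi y ^+ n.
  rewrite -[X in _ = X - _](expr1n _ n) subrXX; congr (_ * _).
  by apply: eq_bigr => i _; rewrite expr1n mul1r.
rewrite -addcharMn; apply: le_trans (cabsD _ _) _; rewrite cabsN -addchar0 !cabs_addchar.
by lra.
Qed.

Lemma sum_addchar y : \sum_x psi (x * y) = if y == 0 then q%:R else 0.
Proof.
case: eqVneq => [->|y0].
  under eq_bigr do rewrite mulr0 addchar0.
  by rewrite sumr_const card_Fp.
have : (1 - psi y) * (\sum_x psi (x * y)) = 0.
  rewrite mulrBl mul1r mulr_sumr [X in X - _](reindex_inj (addrI 1)) /=.
  by apply/eqP; rewrite subr_eq0; apply/eqP; apply: eq_bigr => x _; rewrite mulrDl mul1r addcharD.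
move/eqP; rewrite mulf_eq0 subr_eq0 eq_sym (negPf (addchar_neq1 y0)) /=.
by move/eqP.
Qed.

Lemma parseval (f : F -> R[i]) :
  \sum_y cabs (\sum_x f x * psi (x * y)) ^+ 2 = q%:R * \sum_x cabs (f x) ^+ 2.
Proof.
apply: (@complexI R).
rewrite rmorphM rmorph_sum /= rmorph_nat rmorph_sum /=.
transitivity (\sum_y \sum_x \sum_x' f x * conj (f x') * psi (y * (x - x'))).
  apply: eq_bigr => y _; rewrite cabs_sqr conj_sum mulr_suml.
  apply: eq_bigr => x _; rewrite mulr_sumr; apply: eq_bigr => x' _.
  rewrite conjM conj_addchar mulrACA -addcharD -mulNr -mulrDl.
  by rewrite [(_ - _) * _]mulrC.
rewrite exchange_big /= mulr_sumr; apply: eq_bigr => x _.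
rewrite exchange_big /= (bigD1 x) //= -mulr_sumr subrr.
rewrite [X in _ + X]big1 => [|x' xx']; last first.
  by rewrite -mulr_sumr sum_addchar subr_eq0 eq_sym (negPf xx') mulr0.
by rewrite addr0 sum_addchar eqxx cabs_sqr mulrC.
Qed.

End AdditiveCharacter.

(** * Quadratic polynomials with values in a short interval *)

(** With [phi] constant equal to 1 this compares cardinalities; otherwise it transports weighted
    sums along a map with small fibres. *)
Lemma sum_fiber_le (R : numDomainType) (I J : finType) (P : pred I) (Q : pred J)
    (f : I -> J) (phi : J -> R) (k : nat) :
  (forall i, P i -> Q (f i)) -> (forall j, Q j -> 0 <= phi j) ->
  (forall j, Q j -> (#|[pred i | P i && (f i == j)]| <= k)%N) ->
  \sum_(i | P i) phi (f i) <= k%:R * \sum_(j | Q j) phi j.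
Proof.
move=> PQ phi0 fib.
rewrite (partition_big f Q) //= mulr_sumr; apply: ler_sum => j Qj.
rewrite (eq_bigr (fun=> phi j)) => [|i /andP[_ /eqP->] //].
by rewrite sumr_const -[leLHS]mulr_natl ler_wpM2r ?phi0 // ler_nat fib.
Qed.

(** Sorting pairs by their difference: used for Weyl differencing in the variable of the polynomial
    and for expanding the Fejer kernel in the frequency. *)
Lemma double_sum_diff (V : zmodType) (a : nat -> nat -> V) (L : nat) :
  \sum_(0 <= i < L) \sum_(0 <= j < L) a i j =
  \sum_(0 <= i < L) a i i +
  \sum_(1 <= d < L) (\sum_(0 <= i < L - d) a (i + d)%N i + \sum_(0 <= i < L - d) a i (i + d)%N).
Proof.
elim: L => [|L IH]; first by rewrite !big_geq // addr0.
rewrite big_nat_recr //=.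
under eq_bigr do rewrite big_nat_recr //=.
rewrite big_split /= IH big_nat_recr //= [in RHS]big_nat_recr //= -!addrA; congr (_ + _).
have -> : \sum_(1 <= d < L.+1) (\sum_(0 <= i < L.+1 - d) a (i + d)%N i +
      \sum_(0 <= i < L.+1 - d) a i (i + d)%N) =
    \sum_(1 <= d < L.+1) (\sum_(0 <= i < L - d) a (i + d)%N i +
      \sum_(0 <= i < L - d) a i (i + d)%N) +
    \sum_(1 <= d < L.+1) (a L (L - d)%N + a (L - d)%N L).
  rewrite -big_split /=; apply: eq_big_nat => d /andP[d0 dL].
  have dL' : (d <= L)%N by lia.
  by rewrite subSn // !big_nat_recr //= subnK // addrACA.
have -> : \sum_(1 <= d < L.+1) (\sum_(0 <= i < L - d) a (i + d)%N i +
      \sum_(0 <= i < L - d) a i (i + d)%N) =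
    \sum_(1 <= d < L) (\sum_(0 <= i < L - d) a (i + d)%N i +
      \sum_(0 <= i < L - d) a i (i + d)%N).
  case: L {IH} => [|L]; first by rewrite !big_geq.
  by rewrite big_nat_recr //= subnn !(@big_geq _ _ _ 0 0) // !addr0.
have -> : \sum_(1 <= d < L.+1) (a L (L - d)%N + a (L - d)%N L) =
    \sum_(0 <= i < L) a L i + \sum_(0 <= i < L) a i L.
  rewrite -big_split /= [RHS]big_nat_rev /= big_add1 /=.
  by apply: eq_big_nat => i /andP[_ iL]; rewrite add0n.
by rewrite [RHS]addrCA [X in _ + X = _]addrA [X in _ + X = _]addrC; do 2!congr (_ + _); exact: addrC.
Qed.

Section QuadraticConcentration.
Variables (R : realType) (q : nat).
Hypotheses (q_pr : prime q) (q_odd : odd q).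
Local Notation F := ('F_q).
Local Notation psi := (@addchar R q).
Local Notation conj := (@conjc R).

Variables (D : nat).
Hypothesis D_bound : forall z, (0 < z < q)%N -> (size (divisors z) <= D)%N.

Definition harm_sum : R := \sum_(1 <= k < q) k%:R^-1.

Lemma Fp_nat_neq0 n : (0 < n < q)%N -> n%:R != 0 :> F.
Proof.
move=> /andP[n0 nq]; apply/eqP => /(congr1 (@nat_of_ord _)).
by rewrite /= val_Fp_nat // modn_small // => n_eq0; rewrite n_eq0 in n0.
Qed.

Lemma Fp_two_neq0 : 2 != 0 :> F.
Proof.
by apply: (@Fp_nat_neq0 2); move: q_odd (prime_gt1 q_pr); lia.
Qed.

Lemma sum_Fp_nat (V : nmodType) (P : pred nat) (G : nat -> V) :
  \sum_(y : F | P y) G y = \sum_(k < q | P k) G k.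
Proof. by have := Fp_cast q_pr; move: (Zp_trunc (pdiv q)).+2 => n ->. Qed.

Lemma sum_geom_bound : \sum_(y : F | y != 0) geom_bound R y <= 2 * q%:R * harm_sum.
Proof.
rewrite (eq_bigl (fun y : F => (0 < y)%N)); last first.
  by move=> y; rewrite lt0n.
have -> : \sum_(y : F | (0 < y)%N) geom_bound R y =
    \sum_(1 <= k < q) (q%:R / k%:R + q%:R / (q - k)%:R).
  by rewrite big_geq_mkord /=
    -(@sum_Fp_nat _ (leq 1) (fun k => q%:R / k%:R + q%:R / (q - k)%:R)).
rewrite big_split /= [X in _ + X]big_nat_rev /=.
rewrite [X in _ + X](eq_big_nat _ _ (F2 := fun k => q%:R / k%:R)); last first.
  by move=> i /andP[i0 iq]; congr (_ / _%:R); lia.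
by rewrite -mulr_sumr -/harm_sum; lra.
Qed.


Lemma cabs_shifted_geometric_sum (y z : F) n : y != 0 ->
  cabs (\sum_(0 <= i < n) psi (y *+ i + z)) <= geom_bound R y.
Proof.
move=> y0; under eq_bigr do rewrite addcharD //.
rewrite -mulr_suml cabsM cabs_addchar mulr1 big_mkord.
exact: cabs_geometric_sum.
Qed.

Definition quad (c d e : F) (i : nat) : F := c * i%:R ^+ 2 + d * i%:R + e.

(** At shift [k] the phase difference is linear in [i] with slope [2 * c * h * k], so the inner sum
    is geometric; the part constant in [i] has modulus 1. *)
Lemma weyl_differencing c d e L h : c != 0 -> h != 0 -> (L <= q)%N ->
  cabs (\sum_(0 <= i < L) psi (quad c d e i * h)) ^+ 2 <=
  L%:R + \sum_(1 <= k < L) 2 * geom_bound R (2 * c * h * k%:R).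
Proof.
move=> c0 h0 Lq; set S := \sum_(0 <= i < L) _.
rewrite -(cabs_real (sqr_ge0 (cabs S))) cabs_sqr conj_sum mulr_suml.
under eq_bigr => i _ do rewrite mulr_sumr.
rewrite (double_sum_diff (fun i j => psi (quad c d e i * h) * conj (psi (quad c d e j * h)))).
apply: le_trans (cabsD _ _) _; apply: lerD.
  apply: le_trans (cabs_sum _ _ _) _; rewrite (eq_bigr (fun=> 1)) => [|i _].
    by rewrite sumr_const_nat subn0.
  by rewrite cabsM cabsJ // cabs_addchar mulr1.
apply: le_trans (cabs_sum _ _ _) _.
apply: ler_sum_nat => k /andP[k0 kL].
have y0 : 2 * c * h * k%:R != 0.
  by rewrite !mulf_neq0 ?Fp_two_neq0 ?Fp_nat_neq0 // k0 (leq_trans kL).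
have H : cabs (\sum_(0 <= i < L - k) psi (quad c d e (i + k) * h) *
     conj (psi (quad c d e i * h))) <= geom_bound R (2 * c * h * k%:R).
  rewrite (eq_bigr (fun i => psi ((2 * c * h * k%:R) *+ i + (c * k%:R ^+ 2 + d * k%:R) * h))).
    exact: cabs_shifted_geometric_sum.
  move=> i _; rewrite conj_addchar // -addcharD //; congr psi.
  by rewrite /quad natrD -[_ *+ i]mulr_natr; ring.
apply: le_trans (cabsD _ _) _; rewrite mulr_natl mulr2n; apply: lerD => //.
rewrite -cabsJ conj_sum.
by under eq_bigr do rewrite conjM conjcK mulrC.
Qed.

(** The angle [t] is at most pi/4, so [cos (2 t) = 2 (cos t)^2 - 1] is nonnegative. *)
Lemma Re_eq_add_ge n : (8 * n <= q)%N -> 2^-1 <= complex.Re (eq_add R q n).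
Proof.
move=> h /=; set t := _ / _.
have q0 : 0 < q%:R :> R by rewrite ltr0n prime_gt0.
have p0 := @pi_gt0 R.
have t0 : 0 <= t by rewrite divr_ge0 ?mulr_ge0 // ltW.
have tp : t <= pi / 4.
  rewrite /t ler_pdivrMr //; move: h; rewrite -(ler_nat R) natrM => h.
  by have := ler_wpM2l (ltW p0) h; lra.
have c0 : 0 <= cos t by apply: cos_ge0_pihalf; lra.
have : 0 <= cos (t *+ 2) by apply: cos_ge0_pihalf; lra.
rewrite cos_mulr2n; move: (cos t) c0 => c c0 H.
by rewrite leNgt; apply/negP => c1; nra.
Qed.

Lemma kernel_lower t H K : (t < K)%N -> (8 * (H * K) <= q)%N ->
  H%:R / 2 <= cabs (\sum_(0 <= h < H) psi (t%:R * h%:R)).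
Proof.
move=> tK HK; apply: le_trans (cabs_geRe _).
rewrite (big_morph (@complex.Re R) (id1 := 0) (op1 := +%R)) //; last by move=> [? ?] [? ?].
rewrite (_ : H%:R / 2 = \sum_(0 <= h < H) 2^-1); last first.
  by rewrite sumr_const_nat subn0 mulr_natl.
apply: ler_sum_nat => h /andP[_ hH].
by rewrite -natrM addchar_nat //; apply: Re_eq_add_ge; nia.
Qed.

(** As [h * k < q], the frequency determines the integer [h * k], and an integer has at most [D]
    factorizations; so each nonzero residue is hit at most [D] times. *)
Lemma sum_products_geom_bound (c : F) H L : c != 0 -> (H * L <= q)%N ->
  \sum_(1 <= h < H) \sum_(1 <= k < L) geom_bound R (2 * c * h%:R * k%:R) <=
  D%:R * (2 * q%:R * harm_sum).
Proof.
move=> c0 HL; rewrite big_geq_mkord /=.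
under eq_bigr do rewrite big_geq_mkord /=.
rewrite pair_big /=.
apply: (le_trans _ (ler_wpM2l (ler0n _ D) sum_geom_bound)).
have cc : 2 * c != 0 by rewrite mulf_neq0 ?Fp_two_neq0.
have lt_hk (h : 'I_H) (k : 'I_L) : (h * k < q)%N.
  by apply: leq_trans HL; have := ltn_ord h; have := ltn_ord k; nia.
apply: (@sum_fiber_le _ _ _ _ _ (fun p : 'I_H * 'I_L => 2 * c * (p.1 : nat)%:R * (p.2 : nat)%:R)).
- move=> [h k] /= /andP[h0 k0].
  by rewrite -mulrA -natrM mulf_neq0 // Fp_nat_neq0 // lt_hk muln_gt0 h0 k0.
- by move=> y _; apply: geom_bound_ge0.
move=> y y0; pose z : nat := (y / (2 * c) : F).
have yc0 : y / (2 * c) != 0 by rewrite mulf_neq0 ?invr_eq0.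
have z0 : (0 < z < q)%N by rewrite Fp_gt0 // ltn_Fp.
have zE (h : 'I_H) (k : 'I_L) : 2 * c * (h : nat)%:R * (k : nat)%:R = y -> z = (h * k)%N.
  move=> yE; rewrite /z -yE -[_ * _ * (k : nat)%:R]mulrA mulrAC divff // mul1r.
  by rewrite -natrM val_Fp_nat // modn_small // lt_hk.
apply: leq_trans (D_bound z0).
rewrite cardE -(size_map (fun p : 'I_H * 'I_L => p.1 : nat)); apply: uniq_leq_size.
  rewrite map_inj_in_uniq ?enum_uniq // => -[h k] [h' k'].
  rewrite !mem_enum !inE /= => /andP[/andP[h0 _] /eqP/zE E] /andP[_ /eqP/zE E'] hh.
  have hh' : h = h' by apply: val_inj.
  rewrite hh'; congr (_, _); apply: val_inj; apply/eqP.
  by rewrite -(eqn_pmul2l h0) -E hh -E'.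
move=> u /mapP[[h k]]; rewrite mem_enum inE /= => /andP[_ /eqP/zE E] ->.
by rewrite -dvdn_divisors; [rewrite E dvdn_mulr | case/andP: z0].
Qed.

(** [S] sums an unnormalized Fejer kernel over all [i]: it is nonnegative, and at least
    [(H / 2) ^ 2] at each [i] to be counted. Its expansion consists of quadratic exponential sums
    [g h], bounded in mean square over [h] by Weyl differencing. *)
Lemma quad_concentration_aux c d e K L H : c != 0 -> (0 < H)%N -> (0 < K)%N ->
    (L <= 2 * K)%N -> (8 * (H * K) <= q)%N ->
  #|[pred i : 'I_L | (K <= quad c d e i < 2 * K)%N]|%:R <=
  4 * L%:R / H%:R + 8 * Num.sqrt (L%:R + 4 * D%:R * harm_sum * (q%:R / H%:R)) :> R.
Proof.
move=> c0 H0 K0 LK HK; set J := #|_|.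
(* The shift by [K] moves the target interval to [[0, K)], where the kernel is large. *)
pose x i := quad c d (e - K%:R) i.
pose a h1 h2 : R[i] := \sum_(0 <= i < L) psi (x i * (h1%:R - h2%:R)).
pose g (h : nat) : R := cabs (a h 0%N).
have HR : 0 < H%:R :> R by rewrite ltr0n.
have LqH : (H * L <= q)%N by nia.
have Lq : (L <= q)%N by nia.
pose S : R := \sum_(0 <= i < L) cabs (\sum_(0 <= h < H) psi (x i * h%:R)) ^+ 2.
have lower : J%:R * (H%:R / 2) ^+ 2 <= S.
  rewrite /S big_mkord (bigID (fun i : 'I_L => (K <= quad c d e i < 2 * K)%N)) /=.
  rewrite -[leLHS]addr0; apply: lerD; last by apply: sumr_ge0 => i _; apply: sqr_ge0.
  rewrite mulr_natl -sumr_const; apply: ler_sum => i /andP[h1 h2].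
  have -> : x i = (quad c d e i - K)%N%:R.
    by rewrite natrB // natr_Zp /x /quad addrA.
  apply: lerXn2r; rewrite ?nnegrE ?cabs_ge0 ?divr_ge0 //.
  by apply: kernel_lower HK; lia.
have Sg0 h : 0 <= g h by apply: cabs_ge0.
have conj_a h1 h2 : cabs (a h1 h2) = cabs (a h2 h1).
  rewrite -cabsJ /a conj_sum; congr cabs; apply: eq_bigr => i _.
  by rewrite conj_addchar // -mulrN opprB.
have a_diff i k : cabs (a (i + k)%N i) = g k.
  by rewrite /g /a subr0 natrD [i%:R + _]addrC addrK.
have upper : S <= H%:R * L%:R + 2 * H%:R * \sum_(1 <= k < H) g k.
  have ES : real_complex R S = \sum_(0 <= h1 < H) \sum_(0 <= h2 < H) a h1 h2.
    rewrite /S rmorph_sum /=.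
    rewrite [RHS](eq_bigr (fun h1 => \sum_(0 <= i < L) \sum_(0 <= h2 < H) psi (x i * (h1%:R - h2%:R)))).
      rewrite [RHS]exchange_big /=; apply: eq_bigr => i _.
      rewrite cabs_sqr conj_sum mulr_suml; apply: eq_bigr => h1 _.
      rewrite mulr_sumr; apply: eq_bigr => h2 _.
      by rewrite conj_addchar // -addcharD // mulrBr.
    by move=> h1 _; rewrite exchange_big.
  have S0 : 0 <= S by apply: sumr_ge0 => i _; apply: sqr_ge0.
  rewrite -(cabs_real S0) ES double_sum_diff.
  apply: le_trans (cabsD _ _) _; apply: lerD.
    apply: le_trans (cabs_sum _ _ _) _.
    rewrite (eq_bigr (fun=> L%:R)); first by rewrite sumr_const_nat subn0 mulr_natl.
    move=> h _; rewrite /a subrr (eq_bigr (fun=> 1)).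
      by rewrite sumr_const_nat subn0 -(rmorph_nat (real_complex R)) cabs_real.
    by move=> i _; rewrite mulr0 addchar0.
  apply: le_trans (cabs_sum _ _ _) _; rewrite mulr_sumr.
  apply: ler_sum_nat => k /andP[k0 kH].
  have half b : (forall i, cabs (b i) = g k) ->
      cabs (\sum_(0 <= i < H - k) b i) <= H%:R * g k.
    move=> hb; apply: le_trans (cabs_sum _ _ _) _.
    rewrite (eq_bigr (fun=> g k)) => [|i _ //].
    by rewrite sumr_const_nat subn0 -[leLHS]mulr_natl ler_wpM2r // ler_nat leq_subr.
  apply: le_trans (cabsD _ _) _.
  rewrite (_ : 2 * H%:R * g k = H%:R * g k + H%:R * g k); last by ring.
  by apply: lerD; apply: half => i; rewrite ?[cabs (a i _)]conj_a a_diff.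
(* The frequencies are kept together, so that the products [h * k] spread over the residues; a bound
   for single [h] would lose this average. *)
have second : \sum_(1 <= h < H) g h ^+ 2 <=
    H%:R * L%:R + 4 * D%:R * harm_sum * q%:R.
  apply: (@le_trans _ _ (\sum_(1 <= h < H) (L%:R +
      2 * \sum_(1 <= k < L) geom_bound R (2 * c * h%:R * k%:R)))).
    apply: ler_sum_nat => h /andP[h0 hH].
    rewrite /g /a subr0 mulr_sumr; apply: weyl_differencing => //.
    by apply: Fp_nat_neq0; rewrite h0; nia.
  rewrite big_split /= sumr_const_nat -mulr_sumr; apply: lerD.
    by rewrite -[leLHS]mulr_natl ler_wpM2r // ler_nat leq_subr.
  have := sum_products_geom_bound c0 LqH; lra.
have hsum0 : 0 <= \sum_(1 <= h < H) g h by apply: sumr_ge0.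
have cs : (\sum_(1 <= h < H) g h) ^+ 2 <=
    H%:R * (H%:R * L%:R + 4 * D%:R * harm_sum * q%:R).
  apply: (@le_trans _ _ (H%:R * \sum_(1 <= h < H) g h ^+ 2)); last first.
    by rewrite ler_wpM2l.
  rewrite !big_geq_mkord /=.
  have := @sum_CS R _ (fun i : 'I_H => (0 < i)%N) (fun=> 1) (fun i : 'I_H => g i).
  under [X in X ^+ 2 <= _ -> _]eq_bigr do rewrite mul1r.
  under [X in _ <= X * _ -> _]eq_bigr do rewrite expr1n.
  move/le_trans; apply; apply: ler_wpM2r; first by apply: sumr_ge0 => i _; apply: sqr_ge0.
  rewrite sumr_const ler_nat; apply: leq_trans (max_card _) _; by rewrite card_ord.
set B := L%:R + _.
have B0 : 0 <= B.
  have : 0 <= harm_sum by apply: sumr_ge0 => i _; rewrite invr_ge0.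
  by move=> h0; rewrite addr_ge0 ?mulr_ge0 // ?invr_ge0 // ltW.
have cs' : \sum_(1 <= h < H) g h <= H%:R * Num.sqrt B.
  rewrite -(@ler_pXn2r _ 2) ?nnegrE ?mulr_ge0 ?sqrtr_ge0 //; try by rewrite ltW.
  rewrite exprMn sqr_sqrtr //; apply: le_trans cs _.
  rewrite le_eqVlt; apply/orP; left; apply/eqP; rewrite /B; field.
  by rewrite gt_eqF.
have := le_trans lower upper.
move: (Num.sqrt B) cs' => s cs' main.
rewrite -(ler_pM2r HR) mulrDl divfK ?gt_eqF //.
rewrite -(ler_pM2r HR).
by nra.
Qed.

Lemma harm_sum_ge1 : 1 <= harm_sum.
Proof.
rewrite /harm_sum big_ltn ?prime_gt1 // invr1 lerDl.
by apply: sumr_ge0 => i _; rewrite invr_ge0.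
Qed.

Lemma divisor_bound_ge1 : (0 < D)%N.
Proof. by have := @D_bound 1; rewrite /= prime_gt1 // => /(_ isT). Qed.

Lemma quad_concentration c d e K L : c != 0 -> (0 < K)%N -> (L <= 2 * K)%N ->
  #|[pred i : 'I_L | (K <= quad c d e i < 2 * K)%N]|%:R <=
  128 * (K%:R ^+ 2 / q%:R + Num.sqrt (K%:R * D%:R * harm_sum)) :> R.
Proof.
move=> c0 K0 LK.
have qR : 0 < q%:R :> R by rewrite ltr0n prime_gt0.
have KR : 0 < K%:R :> R by rewrite ltr0n.
have LR : L%:R <= 2 * K%:R :> R by rewrite -natrM ler_nat.
have h1 := harm_sum_ge1.
have D1 : 1 <= D%:R :> R by rewrite ler1n divisor_bound_ge1.
have s0 := sqrtr_ge0 (K%:R * D%:R * harm_sum).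
(* For [8 * K > q] the trivial count [2 K] is at most [16 K^2 / q]. *)
have [HK|HK] := leqP (8 * K) q; last first.
  apply: (@le_trans _ _ (2 * K%:R)).
    apply: le_trans LR; rewrite ler_nat; apply: leq_trans (max_card _) _.
    by rewrite card_ord.
  have : 2 * K%:R <= 16 * (K%:R ^+ 2 / q%:R) :> R.
    rewrite mulrA ler_pdivlMr //; move: HK; rewrite -(ltr_nat R) natrM; nra.
  have : 0 <= K%:R ^+ 2 / q%:R :> R by rewrite divr_ge0 ?sqr_ge0.
  by lra.
(* The largest kernel length allowed, which makes [q / H <= 16 K]. *)
pose H := (q %/ (8 * K))%N.
have H0 : (0 < H)%N by rewrite divn_gt0 ?muln_gt0.
have HKq : (8 * (H * K) <= q)%N.
  by rewrite (_ : 8 * (H * K) = H * (8 * K))%N ?leq_trunc_div //; lia.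
have qHK : (q <= 16 * (H * K))%N.
  have := ltn_ceil q (_ : 0 < 8 * K)%N; rewrite muln_gt0 K0 -/H => /(_ isT); nia.
have HR : 0 < H%:R :> R by rewrite ltr0n.
have qH : q%:R / H%:R <= 16 * K%:R :> R.
  by rewrite ler_pdivrMr //; move: qHK; rewrite -(ler_nat R) !natrM; lra.
apply: le_trans (quad_concentration_aux d e c0 H0 K0 LK HKq) _.
rewrite mulrDr; apply: lerD.
  rewrite mulrA ler_pdivlMr //.
  apply: (@le_trans _ _ (4 * L%:R * (q%:R / H%:R))).
    by rewrite le_eqVlt; apply/orP; left; apply/eqP; ring.
  by have := ler_wpM2l (_ : 0 <= 4 * L%:R) qH; rewrite mulr_ge0 // => /(_ isT); nra.
apply: (@le_trans _ _ (8 * (9 * Num.sqrt (K%:R * D%:R * harm_sum)))); last by lra.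
(* [9^2 = 81] exceeds [2 + 4 * 16], the constants from [L <= 2 K] and [q / H <= 16 K]. *)
rewrite ler_wpM2l // -[9]ger0_norm // -sqrtr_sqr -sqrtrM ?sqr_ge0 // ler_wsqrtr //.
have D0 : 0 <= 4 * D%:R * harm_sum by nra.
have := ler_wpM2l D0 qH.
have : K%:R <= K%:R * D%:R * harm_sum.
  by rewrite -mulrA ler_peMr ?(ltW KR) //; nra.
by nra.
Qed.

End QuadraticConcentration.

(** * Square roots of an interval *)

Section RootSets.
Variables (q : nat).
Hypotheses (q_pr : prime q) (q_odd : odd q).
Local Notation F := ('F_q).

(** For [b <> 0], the integer [n] in [[0, q)] with [x ^ 2 = b * n]. Thus [sqrt_set b K] is the set
    of square roots of the [b * n] with [n] in [[K, 2 K)]. *)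
Definition sqrt_index (b x : F) : nat := (x ^+ 2 / b : F).

Definition sqrt_set (b : F) (K : nat) : {set F} :=
  [set x | (K <= sqrt_index b x < 2 * K)%N].

Definition rep_set (A : {set F}) (w : F) : {set F} := [set x in A | x - w \in A].

Definition rep (A : {set F}) (w : F) : nat := #|rep_set A w|.

Lemma sqrt_indexE b x : b != 0 -> b * (sqrt_index b x)%:R = x ^+ 2.
Proof. by move=> b0; rewrite /sqrt_index natr_Zp mulrC divfK. Qed.

Lemma sqrt_index_fiber b k : b != 0 ->
  (#|[pred x : F | sqrt_index b x == k]| <= 2)%N.
Proof.
move=> b0.
have [x /eqP xk|E] := pickP [pred x : F | sqrt_index b x == k]; last by rewrite eq_card0.
apply: leq_trans (card_size [:: x; - x]); apply/subset_leq_card/fintype.subsetP => y.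
rewrite !inE => /eqP yk; rewrite -eqf_sqr -!(sqrt_indexE _ b0).
by move: xk => /= xk; rewrite yk xk.
Qed.

Lemma card_sqrt_set b K : b != 0 -> (#|sqrt_set b K| <= 2 * K)%N.
Proof.
move=> b0.
pose Q := [pred k : 'I_(2 * K) | (K <= k)%N].
have [->|K0] := posnP K.
  by rewrite muln0 eq_card0 // => x; rewrite inE ltn0 andbF.
have K20 : (0 < 2 * K)%N by rewrite muln_gt0.
pose f (x : F) : 'I_(2 * K) := insubd (Ordinal K20) (sqrt_index b x).
have fE x : x \in sqrt_set b K -> f x = sqrt_index b x :> nat.
  by rewrite inE => /andP[_ h]; rewrite /f val_insubd h.
have := @sum_fiber_le rat F 'I_(2 * K) (fun x => x \in sqrt_set b K) Q f (fun=> 1) 2.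
have -> : \sum_(j | Q j) 1 = K%:R :> rat.
  transitivity (\sum_(K <= j < 2 * K) 1 : rat); first by rewrite big_geq_mkord; apply: eq_bigl.
  by rewrite sumr_const_nat mulSn mul1n addnK.
rewrite sumr_const -natrM ler_nat; apply.
- by move=> x xA; rewrite /= fE //; move: xA; rewrite inE => /andP[].
- by [].
move=> j _; apply: leq_trans (sqrt_index_fiber j b0).
apply/subset_leq_card/fintype.subsetP => x /andP[xA /eqP <-].
by rewrite inE fE.
Qed.

Lemma sum_rep A : (\sum_w rep A w = #|A| ^ 2)%N.
Proof.
rewrite (eq_bigr (fun w => \sum_(x in A) \sum_(y in A) (y == (x - w)%R))%N); last first.
  move=> w _; rewrite /rep -sum1_card big_mkcond [RHS]big_mkcond /=; apply: eq_bigr => x _.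
  rewrite inE; case: (x \in A) => //=.
  rewrite big_mkcond /= (bigD1 (x - w)) //= eqxx big1 ?addn0; first by case: (_ \in _).
  by move=> y /negPf ->; case: ifP.
rewrite exchange_big /= (eq_bigr (fun=> #|A|)); first by rewrite sum_nat_const mulnn.
move=> x xA; rewrite exchange_big /= -sum1_card; apply: eq_bigr => y yA.
rewrite (bigD1 (x - y)) //= subKr eqxx big1 //.
by move=> w wxy; apply/eqP; rewrite eqb0; apply: contra wxy => /eqP ->; rewrite subKr.
Qed.

Lemma rep0 A : rep A 0 = #|A|.
Proof. by rewrite /rep; apply: eq_card => x; rewrite inE subr0 andbb. Qed.

Variables (b : F) (K : nat) (w : F).
Hypotheses (b0 : b != 0) (w0 : w != 0).

Definition rep_diff (x : F) : int := (sqrt_index b x)%:Z - (sqrt_index b (x - w))%:Z.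

(** [x ^ 2 - (x - w) ^ 2] is linear in [x]; hence for [w <> 0] the integer [rep_diff x] determines
    [x]. *)
Lemma rep_diffE x : b * (rep_diff x)%:~R = w * (2 * x - w).
Proof.
rewrite /rep_diff intrD mulrDr intrN mulrN !sqrt_indexE //.
by ring.
Qed.

Lemma rep_diff_inj : injective rep_diff.
Proof.
move=> x y E; have := rep_diffE x; rewrite E rep_diffE => /(mulfI w0) /(addIr (- w)).
by move/(mulfI (Fp_two_neq0 q_pr q_odd)) => ->.
Qed.

Variables (R : realType) (D : nat).
Hypothesis D_bound : forall z, (0 < z < q)%N -> (size (divisors z) <= D)%N.

Lemma rep_pointwise : (0 < K)%N ->
  (rep (sqrt_set b K) w)%:R <=
  128 * (K%:R ^+ 2 / q%:R + Num.sqrt (K%:R * D%:R * harm_sum R q)) :> R.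
Proof.
move=> K0.
have two0 := Fp_two_neq0 q_pr q_odd.
(* Solving [b s = w (2 x - w)] for [x] with [s = idx x - K] gives [x = x0 + del * idx x], so the
   index of [x] is quadratic in [idx x]. *)
pose x0 := (w ^+ 2 - b * K%:R) / (2 * w); pose del := b / (2 * w).
have del0 : del != 0 by rewrite mulf_neq0 ?invr_eq0 ?mulf_neq0.
pose c := del ^+ 2 / b; pose d := 2 * x0 * del / b; pose e := x0 ^+ 2 / b.
have c0 : c != 0 by rewrite mulf_neq0 ?invr_eq0 ?expf_neq0.
apply: le_trans (quad_concentration R q_pr q_odd D_bound d e c0 K0 (leqnn _)).
rewrite ler_nat.
have K20 : (0 < 2 * K)%N by rewrite muln_gt0.
(* The difference of the indices shifted by [K] into [[0, 2 K)]; on the set in question the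
   subtraction does not truncate. *)
pose idx x := (sqrt_index b x + K - sqrt_index b (x - w)%R)%N.
pose f (x : F) : 'I_(2 * K) := insubd (Ordinal K20) (idx x).
have idxE x : x \in rep_set (sqrt_set b K) w ->
    (idx x < 2 * K)%N /\ (idx x)%:Z = rep_diff x + K%:Z.
  rewrite !inE => /andP[/andP[h1 h2] /andP[h3 h4]]; rewrite /idx /rep_diff.
  by split; lia.
have fE x : x \in rep_set (sqrt_set b K) w -> f x = idx x :> nat.
  by move=> /idxE[h _]; rewrite /f val_insubd h.
rewrite /rep -(card_in_imset (f := f)); last first.
  move=> x y xA yA /(congr1 val); rewrite /= !fE // => E.
  apply: rep_diff_inj; apply: (addIr K%:Z).
  by rewrite -(idxE x xA).2 -(idxE y yA).2 E.
apply/subset_leq_card/fintype.subsetP => i /imsetP[x xA ->].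
rewrite inE fE //.
suff -> : quad c d e (idx x) = x ^+ 2 / b by move: xA; rewrite !inE => /andP[].
have xE : x = x0 + del * (idx x)%:R.
  have -> : (idx x)%:R = (rep_diff x)%:~R + K%:R :> F.
    by rewrite -[LHS]/((idx x)%:Z%:~R) (idxE x xA).2 intrD.
  have := rep_diffE x; rewrite /x0 /del => E.
  have -> : (rep_diff x)%:~R = w * (2 * x - w) / b :> F.
    by rewrite -E mulrAC divff // mul1r.
  by field; rewrite w0 b0.
rewrite {2}xE /quad /c /d /e.
by field.
Qed.

End RootSets.

(** * Lattice points in a box *)

Lemma ltn_eq_divn m n a : (0 < a)%N -> (m %/ a = n %/ a)%N -> (m < n + a)%N.
Proof.
move=> a0 e; rewrite {1}(divn_eq m a) {1}(divn_eq n a) e -addnA ltn_add2l.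
by apply: ltn_addl; apply: ltn_pmod.
Qed.

(* The points of a planar lattice of determinant q lie on few lines parallel to a
   shortest vector (u0, v0), and consecutive ones on a line are at least that far apart. *)
Lemma lattice_strip_count (I : finType) (P : pred I) (u v : I -> int) (i0 : I) (U V q : nat) :
    (0 < q)%N ->
    (forall i, P i -> (`|u i| < U)%N /\ (`|v i| < V)%N) ->
    P i0 -> u i0 != 0 -> (`|v i0| * U <= `|u i0| * V)%N ->
    (forall i, P i -> (q %| u i0 * v i - v i0 * u i)%Z) ->
    (forall i j, P i -> P j -> i != j ->
      (`|u i0| * V <= `|(u i - u j)%R| * V)%N \/ (`|u i0| * V <= `|(v i - v j)%R| * U)%N) ->
  (#|P| * (q * `|u i0|) <= (4 * (`|u i0| * V) + q) * (3 * U))%N.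
Proof.
move=> q0 box Pi0 u0 slope det mind.
set a := `|u i0|%N in slope mind *.
have a0 : (0 < a)%N by rewrite absz_gt0.
have [aU v0V] := box _ Pi0; rewrite -/a in aU.
(* [k i] numbers the line through point [i] parallel to the shortest vector, and [kap] bounds its
   absolute value. *)
pose kap := ((2 * (a * V)) %/ q)%N.
pose k i := ((u i0 * v i - v i0 * u i) %/ q)%Z.
have kE i : P i -> u i0 * v i - v i0 * u i = k i * q by move=> Pi; rewrite divzK // det.
have kb i : P i -> (`|k i| <= kap)%N.
  move=> Pi; rewrite /kap leq_divRL // -[X in (_ * X <= _)%N]/(`|q%:Z|%N) -abszM -kE //.
  have [h1 h2] := box _ Pi.
  have hX : (`|(u i0 * v i)%R| <= a * V)%N by rewrite abszM leq_mul2l (ltnW h2) orbT.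
  have hY : (`|(v i0 * u i)%R| <= a * V)%N.
    by rewrite abszM (leq_trans _ slope) // leq_mul2l (ltnW h1) orbT.
  by lia.
(* Each line is cut into cells of [u]-length [a]. Both coordinates are shifted to be nonnegative and
   stay in range, so [inord] never defaults. *)
pose f i : 'I_(2 * kap).+1 * 'I_((2 * U) %/ a).+1 :=
  (inord `|(k i + kap%:Z)%R|%N, inord (`|(u i + U%:Z)%R| %/ a)%N).
have finj : {in P &, injective f}.
  move=> i j Pi Pj [] /(congr1 val) /= e1 /(congr1 val) /= e2.
  have := kb _ Pi; have := kb _ Pj => kj ki.
  have [ui vi] := box _ Pi; have [uj vj] := box _ Pj.
  move: e1; rewrite !inordK; [|lia|lia] => e1.
  have kk : k i = k j by lia.
  move: e2; rewrite !inordK; last 2 first.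
  - by rewrite ltnS; apply: leq_div2r; lia.
  - by rewrite ltnS; apply: leq_div2r; lia.
  move=> e2.
  have du : (`|(u i - u j)%R| < a)%N.
    have := ltn_eq_divn a0 e2; have := ltn_eq_divn a0 (esym e2).
    by clear -ui uj; lia.
  (* On a common line the difference is proportional to [(u i0, v i0)], so a small [u]-part forces a
     small [v]-part, against the minimal distance. *)
  have E : u i0 * (v i - v j) = v i0 * (u i - u j).
    have := kE _ Pi; rewrite kk -kE // !mulrBr; clear; lia.
  have E' : (a * `|(v i - v j)%R| = `|v i0| * `|(u i - u j)%R|)%N by rewrite -!abszM E.
  apply/eqP; apply: contraT => ij; have V0 : (0 < V)%N := leq_ltn_trans (leq0n _) vi.
  have [h|h] := mind _ _ Pi Pj ij; first by move: h; rewrite leq_pmul2r // leqNgt du.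
  have h1 : (a * (a * V) <= a * (`|(u i - u j)%R| * V))%N.
    apply: (leq_trans (n := a * (`|(v i - v j)%R| * U))); first by rewrite leq_mul2l h orbT.
    by rewrite mulnA E' mulnAC [X in (_ <= X)%N]mulnCA [X in (_ <= X)%N]mulnC leq_mul2r slope orbT.
  by move: h1; rewrite leq_pmul2l // leq_pmul2r // leqNgt du.
have : (#|P| <= (2 * kap).+1 * ((2 * U) %/ a).+1)%N.
  rewrite -(card_in_imset finj); apply: leq_trans (max_card _) _.
  by rewrite card_prod !card_ord.
have h1 : (q * (2 * kap).+1 <= 4 * (a * V) + q)%N.
  by have := leq_trunc_div (2 * (a * V)) q; rewrite -/kap; clear; nia.
have h2 : (a * ((2 * U) %/ a).+1 <= 3 * U)%N.
  by have := leq_trunc_div (2 * U) a; clear -aU; move: (_ %/ _)%N => d; nia.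
move=> h; apply: leq_trans (leq_mul h1 h2).
by rewrite mulnACA [X in (X <= _)%N]mulnC leq_mul2l h orbT.
Qed.

(** * Small points (z, y) of the lattices t z = y modulo q *)

Section ModularBox.
Variables (R : realType) (q : nat).
Hypothesis q_pr : prime q.
Local Notation F := ('F_q).
Variables (B Y : nat).
Hypotheses (B_gt0 : (0 < B)%N) (Y_gt0 : (0 < Y)%N) (Yq : (Y <= q)%N).
Local Notation I := ('I_(2 * B) * 'I_(2 * Y))%type.

(** The finite type [I] encodes the integer points of [[-B, B) x [-Y, Y)] by translation, so that
    they can be counted and summed over. *)
Definition box_z (i : I) : int := (i.1 : nat)%:Z - B%:Z.
Definition box_y (i : I) : int := (i.2 : nat)%:Z - Y%:Z.

Definition box_pt (i : I) : bool :=
  [&& (`|box_z i| < B)%N, (`|box_y i| < Y)%N & box_z i != 0].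

Definition box_lattice (t : F) (i : I) : bool :=
  box_pt i && (t * (box_z i)%:~R == (box_y i)%:~R).

(** The product of [B / |z|] and [Y / |y|], which bounds the square of the smaller one, the
    reciprocal of the scaled norm. Unlike that square it factors, so its sum is a product of
    harmonic sums. *)
Definition box_weight (i : I) : R := B%:R * Y%:R / (`|box_z i|%N%:R * `|box_y i|%N%:R).

Definition box_mass (t : F) : R := \sum_(i | box_lattice t i && (box_y i != 0)) box_weight i.

Lemma box_weight_ge0 i : 0 <= box_weight i.
Proof. by rewrite divr_ge0 ?mulr_ge0. Qed.

Lemma intr_Fp_eq0 (x : int) : ((x%:~R : F) == 0) = (q %| x)%Z.
Proof.
have natE (n : nat) : ((n%:R : F) == 0) = (q %| n)%N.
  by rewrite (dvdn_pcharf (pchar_Fp q_pr)).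
by case: x => n; rewrite ?NegzE ?mulrNz ?oppr_eq0 natE.
Qed.

Lemma box_point (z y : int) : (`|z| < B)%N -> (`|y| < Y)%N ->
  {i : I | box_z i = z & box_y i = y}.
Proof.
move=> zB yY.
have hz : (`|(z + B%:Z)%R| < 2 * B)%N by clear -zB; lia.
have hy : (`|(y + Y%:Z)%R| < 2 * Y)%N by clear -yY; lia.
by exists (Ordinal hz, Ordinal hy); rewrite /box_z /box_y /=; clear -zB yY; lia.
Qed.

Lemma box_inj (i j : I) : box_z i = box_z j -> box_y i = box_y j -> i = j.
Proof.
case: i j => [i1 i2] [j1 j2]; rewrite /box_z /box_y /= => /addIr [e1] /addIr [e2].
by congr (_, _); apply: val_inj.
Qed.

Lemma box_lattice_det t i j : box_lattice t i -> box_lattice t j ->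
  (q %| box_z i * box_y j - box_y i * box_z j)%Z.
Proof.
move=> /andP[_ /eqP ei] /andP[_ /eqP ej].
by rewrite -intr_Fp_eq0 intrD intrN !intrM -ei -ej; apply/eqP; ring.
Qed.

(** If the [z]-parts agreed, [q] would divide the difference of the [y]-parts, which is smaller than
    [Y <= q]; so distinct points differ in [z]. *)
Lemma box_lattice_sub t i j : box_lattice t i -> box_lattice t j -> i != j ->
    (`|(box_z i - box_z j)%R| < B)%N -> (`|(box_y i - box_y j)%R| < Y)%N ->
  exists2 k, box_lattice t k & box_z k = box_z i - box_z j /\ box_y k = box_y i - box_y j.
Proof.
move=> ti tj ij zB yY; have [k kz ky] := box_point zB yY.
have [/and3P[_ _ zi0] /eqP ei] := andP ti; have [/and3P[_ _ zj0] /eqP ej] := andP tj.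
exists k => //; have tk : t * (box_z k)%:~R = (box_y k)%:~R.
  have castB (m n : int) : (m - n)%:~R = m%:~R - n%:~R :> F by exact: rmorphB.
  by rewrite kz ky (castB (box_z i)) (castB (box_y i)) mulrBr ei ej.
rewrite /box_lattice tk eqxx andbT /box_pt kz ky zB yY /=; apply: contra ij => /eqP z0.
move: tk; rewrite kz z0 ky mulr0z mulr0 => /esym/eqP; rewrite intr_Fp_eq0 => dvd.
have y0 : box_y i - box_y j = 0.
  apply/eqP; rewrite -absz_eq0 -leqn0 leqNgt; apply: contraTN (leq_trans yY Yq) => y0.
  by rewrite -leqNgt dvdn_leq.
by apply/eqP/box_inj; apply/eqP; rewrite -subr_eq0 ?z0 ?y0.
Qed.

(** The strip count along a shortest vector gives [T <= 12 X + 3 m], where [X] is the area term and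
    [m] comes from that vector. Its own weight, one term of [box_mass t], dominates [m ^+ 2]. *)
Lemma box_lattice_count t : t != 0 ->
  #|box_lattice t|%:R ^+ 2 <= 450 * (B%:R * Y%:R / q%:R) ^+ 2 + 18 * box_mass t.
Proof.
move=> t0.
have q0 := prime_gt0 q_pr.
have qR : 0 < q%:R :> R by rewrite ltr0n.
have BR : 0 < B%:R :> R by rewrite ltr0n.
have YR : 0 < Y%:R :> R by rewrite ltr0n.
have mass0 : 0 <= box_mass t by apply: sumr_ge0 => i _; apply: box_weight_ge0.
have [i0 Pi0|P0] := pickP (box_lattice t); last first.
  rewrite eq_card0 // mulr0n expr2 mul0r.
  apply: addr_ge0; apply: mulr_ge0; [exact: ler0n|exact: sqr_ge0|exact: ler0n|exact: mass0].
(* The box norm times [B * Y]. Points of the box have [nrm] below [B * Y], so a difference shorter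
   than the minimum lies in the box again and contradicts minimality. *)
pose nrm i := maxn (`|box_z i| * Y) (`|box_y i| * B).
have [i Pi imin] := arg_minnP nrm Pi0.
have Pbox j : box_lattice t j -> [/\ (`|box_z j| < B)%N, (`|box_y j| < Y)%N & box_z j != 0].
  by case/andP => /and3P[].
have [zB yY z0] := Pbox _ Pi.
have nrmBY : (nrm i < B * Y)%N by rewrite /nrm gtn_max; apply/andP; split; nia.
have mind j k : box_lattice t j -> box_lattice t k -> j != k ->
    (nrm i <= `|(box_z j - box_z k)%R| * Y)%N \/ (nrm i <= `|(box_y j - box_y k)%R| * B)%N.
  move=> Pj Pk jk; case: (leqP (nrm i) (`|(box_z j - box_z k)%R| * Y)) => h1; first by left.
  case: (leqP (nrm i) (`|(box_y j - box_y k)%R| * B)) => h2; first by right.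
  have [||l Pl [lz ly]] := box_lattice_sub Pj Pk jk.
  - by rewrite -(ltn_pmul2r Y_gt0); apply: ltn_trans nrmBY.
  - by rewrite -(ltn_pmul2r B_gt0) [(Y * B)%N]mulnC; apply: ltn_trans nrmBY.
  by have := imin _ Pl; rewrite {2}/nrm lz ly leqNgt gtn_max h1 h2.
have zR : 0 < `|box_z i|%N%:R :> R by rewrite ltr0n absz_gt0.
set T := #|_|; set X : R := B%:R * Y%:R / q%:R.
have X0 : 0 <= X by rewrite divr_ge0 ?mulr_ge0.
have TR0 : 0 <= T%:R :> R by [].
(* m stands for the reciprocal of the norm of the shortest vector *)
have concl m : 0 <= m -> T%:R <= 12 * X + 3 * m ->
    (box_y i = 0 -> m <= X) -> (box_y i != 0 -> m ^+ 2 <= box_weight i) ->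
    T%:R ^+ 2 <= 450 * X ^+ 2 + 18 * box_mass t.
  move=> m0 TXm hm0 hm1.
  have [y0|y0] := eqVneq (box_y i) 0.
    have := hm0 y0 => mX.
    have TX : T%:R <= 15 * X by lra.
    by have := ler_pM TR0 TR0 TX TX; rewrite -!expr2; nra.
  have wm : box_weight i <= box_mass t.
    rewrite /box_mass (bigD1 i) /=; last by rewrite Pi y0.
    by rewrite lerDl; apply: sumr_ge0 => j _; apply: box_weight_ge0.
  have := hm1 y0; have := ler_pM TR0 TR0 TXm TXm; rewrite -!expr2 => h1 h2.
  (* The square is at most [2 (12 X)^2 + 2 (3 m)^2], and [288 <= 450]. *)
  have : (12 * X + 3 * m) ^+ 2 <= 450 * X ^+ 2 + 18 * m ^+ 2.
    by have := sqr_ge0 (12 * X - 3 * m); have := sqr_ge0 X; nra.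
  by lra.
case: (leqP (`|box_y i| * B) (`|box_z i| * Y)) => cmp.
  have nE : nrm i = (`|box_z i| * Y)%N by rewrite /nrm; apply/maxn_idPl.
  have := @lattice_strip_count _ (box_lattice t) box_z box_y i B Y q q0 _ Pi z0 cmp.
  rewrite -nE => /(_ _ _ mind) H.
  have {}H : (T * (q * `|box_z i|) <= (4 * (`|box_z i| * Y) + q) * (3 * B))%N.
    rewrite -nE; apply: H => j Pj; first by case: (Pbox _ Pj).
    exact: box_lattice_det Pi Pj.
  apply: (concl (B%:R / `|box_z i|%N%:R)).
  - by rewrite divr_ge0.
  - move: H; rewrite -(ler_nat R) !(natrM, natrD) => H.
    have qz : 0 < q%:R * `|box_z i|%N%:R :> R by rewrite mulr_gt0.
    rewrite -(ler_pM2r qz); apply: le_trans H _.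
    rewrite le_eqVlt; apply/orP; left; apply/eqP; rewrite /X; field.
    by rewrite !gt_eqF.
  (* A horizontal shortest vector has [q] dividing [z], since [t <> 0]; then
     [B / |z| <= B / q <= X]. *)
  - move=> y0; have /andP[_ /eqP] := Pi; rewrite y0 mulr0z => /eqP.
    rewrite mulf_eq0 (negPf t0) /= intr_Fp_eq0 => dvd.
    have qz : (q <= `|box_z i|)%N by apply: dvdn_leq => //; rewrite absz_gt0.
    rewrite /X ler_pdivrMr // mulrAC ler_pdivlMr //.
    have : q%:R <= `|box_z i|%N%:R :> R by rewrite ler_nat.
    have : 1 <= Y%:R :> R by rewrite ler1n.
    move=> hY hz; apply: (le_trans (ler_wpM2l (ltW BR) hz)).
    by rewrite -mulrA (ler_wpM2l (ltW BR)) // ler_peMl // ltW.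
  move=> y0; have yR : 0 < `|box_y i|%N%:R :> R by rewrite ltr0n absz_gt0.
  move: cmp; rewrite -(ler_nat R) !natrM => cmp.
  rewrite /box_weight ler_pdivlMr ?mulr_gt0 // exprMn exprVn mulrAC ler_pdivrMr ?exprn_gt0 //.
  have := ler_wpM2l (_ : 0 <= B%:R * `|box_z i|%N%:R) cmp; rewrite mulr_ge0 // => /(_ isT).
  by lra.
(* The mirror case: the norm is attained by [y], the coordinates are exchanged and the determinant
   changes sign. *)
have y0 : box_y i != 0 by apply: contraTneq cmp => ->; rewrite absz0 mul0n ltn0.
have yR : 0 < `|box_y i|%N%:R :> R by rewrite ltr0n absz_gt0.
have nE : nrm i = (`|box_y i| * B)%N by rewrite /nrm; apply/maxn_idPr/ltnW.
have := @lattice_strip_count _ (box_lattice t) box_y box_z i Y B q q0 _ Pi y0 (ltnW cmp).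
rewrite -nE => H.
have {}H : (T * (q * `|box_y i|) <= (4 * (`|box_y i| * B) + q) * (3 * Y))%N.
  rewrite -nE; apply: H => [j Pj|j Pj|j k Pj Pk jk]; first by case: (Pbox _ Pj).
    by rewrite dvdzE -[X in (_ %| X)%N]abszN opprB -dvdzE; exact: box_lattice_det Pi Pj.
  by have [] := mind _ _ Pj Pk jk; [right|left].
apply: (concl (Y%:R / `|box_y i|%N%:R)).
- by rewrite divr_ge0.
- move: H; rewrite -(ler_nat R) !(natrM, natrD) => H.
  have qz : 0 < q%:R * `|box_y i|%N%:R :> R by rewrite mulr_gt0.
  rewrite -(ler_pM2r qz); apply: le_trans H _.
  rewrite le_eqVlt; apply/orP; left; apply/eqP; rewrite /X; field.
  by rewrite !gt_eqF.
- by move=> E; rewrite E eqxx in y0.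
move=> _; move: cmp => /ltnW; rewrite -(ler_nat R) !natrM => cmp.
rewrite /box_weight ler_pdivlMr ?mulr_gt0 // exprMn exprVn mulrAC ler_pdivrMr ?exprn_gt0 //.
have := ler_wpM2l (_ : 0 <= Y%:R * `|box_y i|%N%:R) cmp; rewrite mulr_ge0 // => /(_ isT).
by lra.
Qed.

Lemma sum_inv_dist n : (0 < n)%N ->
  \sum_(i < 2 * n | (`|((i : nat)%:Z - n%:Z)%R| < n)%N && ((i : nat)%:Z - n%:Z != 0))
    `|((i : nat)%:Z - n%:Z)%R|%N%:R^-1 <= 2 * harm_sum R n.
Proof.
move=> n0; rewrite /harm_sum big_geq_mkord /=.
pose f (i : 'I_(2 * n)) : 'I_n := insubd (Ordinal n0) `|((i : nat)%:Z - n%:Z)%R|%N.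
have fE (i : 'I_(2 * n)) : (`|((i : nat)%:Z - n%:Z)%R| < n)%N ->
    f i = `|((i : nat)%:Z - n%:Z)%R|%N :> nat by move=> h; rewrite /f val_insubd h.
rewrite (eq_bigr (fun i => (f i : nat)%:R^-1)) => [|i /andP[h _]]; last by rewrite fE.
apply: (@sum_fiber_le _ _ _ _ _ f (fun j : 'I_n => (j : nat)%:R^-1 : R)).
- by move=> i /andP[h1 h2]; rewrite /= fE // absz_gt0.
- by move=> j _; rewrite invr_ge0.
move=> j _.
have hj := ltn_ord j.
have h1 : (n + j < 2 * n)%N by lia.
have h2 : (n - j < 2 * n)%N by lia.
apply: leq_trans (card_size [:: Ordinal h1; Ordinal h2]).
apply/subset_leq_card/fintype.subsetP => i /andP[/andP[h _] /eqP E].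
move: (congr1 val E); rewrite /= fE // => E'.
by rewrite !inE; apply/orP; case: (leqP n i) => hh; [left|right]; apply/eqP/val_inj => /=; lia.
Qed.

(** A point with [0 < |y| < Y <= q] lies on at most one lattice: either [z] is invertible and
    [t = y / z], or [q] divides [z] and no [t] works. *)
Lemma sum_box_mass :
  \sum_t box_mass t <= 4 * (B%:R * Y%:R) * (harm_sum R B * harm_sum R Y).
Proof.
rewrite /box_mass (exchange_big_dep (fun i => box_pt i && (box_y i != 0))) /=; last first.
  by move=> t i _ /andP[/andP[-> _] ->].
apply: (@le_trans _ _ (\sum_(i | box_pt i && (box_y i != 0)) box_weight i)).
  apply: ler_sum => i /andP[/and3P[_ yY z0] y0].
  rewrite sumr_const -[leLHS]mulr_natl ler_piMl ?box_weight_ge0 // lern1.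
  apply/card_le1_eqP => t t' /andP[/andP[_ /eqP e1] _] /andP[/andP[_ /eqP e2] _].
  have zF : (box_z i)%:~R != 0 :> F.
    apply/eqP => zF; move/eqP: e1; rewrite zF mulr0 eq_sym intr_Fp_eq0 => dvd.
    have : (q <= `|box_y i|)%N by apply: dvdn_leq => //; rewrite absz_gt0.
    by rewrite leqNgt (leq_trans yY).
  by apply: (mulIf zF); rewrite e1 e2.
have E : \sum_(i | box_pt i && (box_y i != 0)) box_weight i =
    B%:R * Y%:R *
    ((\sum_(i < 2 * B | (`|((i : nat)%:Z - B%:Z)%R| < B)%N && ((i : nat)%:Z - B%:Z != 0))
       `|((i : nat)%:Z - B%:Z)%R|%N%:R^-1) *
     (\sum_(i < 2 * Y | (`|((i : nat)%:Z - Y%:Z)%R| < Y)%N && ((i : nat)%:Z - Y%:Z != 0))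
       `|((i : nat)%:Z - Y%:Z)%R|%N%:R^-1)).
  rewrite mulr_suml; under [in RHS]eq_bigr do rewrite mulr_sumr.
  rewrite pair_big /= mulr_sumr; apply: eq_big => [[i j]|[i j] _].
    by rewrite /box_pt /box_z /box_y /= -!andbA; congr (_ && _); exact: andbCA.
  by rewrite /box_weight /box_z /box_y /= invfM.
rewrite {}E.
have h0 n : 0 <= harm_sum R n by apply: sumr_ge0 => i _; rewrite invr_ge0.
rewrite (_ : 4 * _ * _ = B%:R * Y%:R * ((2 * harm_sum R B) * (2 * harm_sum R Y))); last by ring.
apply: ler_wpM2l; first by rewrite mulr_ge0.
by apply: ler_pM; rewrite ?sum_inv_dist //; apply: sumr_ge0 => i _; rewrite invr_ge0.
Qed.

End ModularBox.

(** * The fourth moment of the representation function *)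

(** In [(s x - s y) (s x + s y) = z] the first factor is a signed divisor of [z], and it determines
    both [s x] and [s y]. *)
Lemma card_diff_squares (T : finType) (S : pred T) (s : T -> int) (z : int) :
  injective s -> z != 0 ->
  (#|[pred p : T * T | (S p.1 && S p.2) && (s p.1 ^+ 2 - s p.2 ^+ 2 == z)%R]| <=
   2 * size (divisors `|z|))%N.
Proof.
move=> s_inj z0.
apply: (@leq_trans (size [seq (a, d) | a <- [:: true; false], d <- divisors `|z|]));
  last by rewrite size_allpairs.
pose g (p : T * T) := (0 < s p.1 - s p.2, `|(s p.1 - s p.2)%R|%N).
rewrite cardE -(size_map g); apply: uniq_leq_size.
  rewrite map_inj_in_uniq ?enum_uniq // => -[x y] [x' y'].
  rewrite !mem_enum !inE /= => /andP[_ /eqP E] /andP[_ /eqP E'] [e1 e2].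
  have dE : s x - s y = s x' - s y' by clear -e1 e2; lia.
  have d0 : s x - s y != 0.
    by apply: contra z0 => /eqP d0; rewrite -E subr_sqr d0 mul0r.
  have aE : s x + s y = s x' + s y'.
    by apply: (mulfI d0); rewrite -subr_sqr dE -subr_sqr E E'.
  by congr (_, _); apply: s_inj; clear -dE aE; lia.
move=> u /mapP[[x y]]; rewrite mem_enum => /andP[_ /eqP E] ->.
rewrite /= in E; apply/allpairsP; exists (g (x, y)); split => //=; first by case: (0 < _).
rewrite -dvdn_divisors ?absz_gt0 // -[X in (_ %| X)%N]/(`|z|%N) -E subr_sqr abszM.
exact: dvdn_mulr.
Qed.

Lemma harm_sum_le (R : realType) m n : (m <= n)%N -> harm_sum R m <= harm_sum R n.
Proof.
move=> mn; rewrite /harm_sum; have [m1|m1] := leqP 1 m; last first.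
  by rewrite big_geq; [apply: sumr_ge0 => i _; rewrite invr_ge0 | lia].
by rewrite [leRHS](big_cat_nat m1 mn) /= lerDl; apply: sumr_ge0 => i _; rewrite invr_ge0.
Qed.

Section FourthMoment.
Variables (R : realType) (q : nat).
Hypotheses (q_pr : prime q) (q_odd : odd q).
Local Notation F := ('F_q).
Variables (D : nat).
Hypothesis D_bound : forall z, (0 < z < q ^ 2)%N -> (size (divisors z) <= D)%N.
Variables (b : F) (K : nat).
Hypotheses (b0 : b != 0) (K0 : (0 < K)%N) (Kq : (2 * K <= q)%N).
Local Notation A := (sqrt_set b K).
Local Notation theta w := (b / (2 * w ^+ 2)).

Hypothesis D_ge : (100 <= D)%N.

(** Pairs of representations are sent to lattice points [(z, y)]. The pairs with [z = 0] have
    [s' = s] or [s' = - s], at most two for each [x]; every other point comes from at most [2 * D]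
    pairs. *)
Lemma rep_sqr_le w : w != 0 ->
  (rep A w ^ 2 <= 2 * rep A w + 2 * D * #|@box_lattice q (K ^ 2) (2 * K) (theta w)|)%N.
Proof.
move=> w0.
have two0 := Fp_two_neq0 q_pr q_odd.
set S := rep_set A w; pose s := rep_diff b w.
have s_inj : injective s by apply: rep_diff_inj.
(* Sums of two indices lie in [[2 K, 4 K - 2]], so their differences are below [2 K], the second
   side of the box. *)
pose Y x : int := (sqrt_index b x)%:Z + (sqrt_index b (x - w))%:Z.
have bounds x : x \in S -> [/\ (`|s x| < K)%N, 2 * K%:Z <= Y x & Y x < 4 * K%:Z - 1].
  by rewrite !inE => /andP[/andP[h1 h2] /andP[h3 h4]]; rewrite /s /rep_diff /Y; split; lia.
have YE x : b * (Y x)%:~R = x ^+ 2 + (x - w) ^+ 2.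
  by rewrite /Y intrD mulrDr !sqrt_indexE.
(* From [2 (x^2 + (x - w)^2) - w^2 = (2 x - w)^2] and [b s = w (2 x - w)]: [theta w * s^2] equals
   [Y x] up to a term independent of [x]. *)
have rel x x' : theta w * (s x ^+ 2 - s x' ^+ 2)%:~R = (Y x - Y x')%:~R.
  have E t : b ^+ 2 * (s t ^+ 2)%:~R = w ^+ 2 * (2 * (b * (Y t)%:~R) - w ^+ 2).
    rewrite YE !expr2 intrM mulrACA rep_diffE //; ring.
  have E' t : (s t ^+ 2)%:~R = w ^+ 2 * (2 * (b * (Y t)%:~R) - w ^+ 2) / b ^+ 2 :> F.
    by rewrite -E mulrAC divff ?mul1r // expf_neq0.
  have castB (m n : int) : (m - n)%:~R = m%:~R - n%:~R :> F by exact: rmorphB.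
  by rewrite (castB (s x ^+ 2)) (castB (Y x)) !E'; field; rewrite w0 b0 two0.
have K2_gt0 : (0 < K ^ 2)%N by rewrite expn_gt0 K0.
have K20 : (0 < 2 * K)%N by rewrite muln_gt0.
pose z (p : F * F) : int := s p.1 ^+ 2 - s p.2 ^+ 2.
pose y (p : F * F) : int := Y p.1 - Y p.2.
have zyb p : (p.1 \in S) && (p.2 \in S) -> (`|z p| < K ^ 2)%N /\ (`|y p| < 2 * K)%N.
  case: p => x x' /= /andP[/bounds[h1 h2 h3] /bounds[h4 h5 h6]]; split; last by rewrite /y /=; lia.
  rewrite /z /=; have : (`|(s x ^+ 2)%R| < K ^ 2)%N by rewrite abszX ltn_sqr.
  have : (`|(s x' ^+ 2)%R| < K ^ 2)%N by rewrite abszX ltn_sqr.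
  by have := sqr_ge0 (s x); have := sqr_ge0 (s x'); lia.
have h1 : (0 < 2 * K ^ 2)%N by rewrite muln_gt0.
have h2 : (0 < 2 * (2 * K))%N by rewrite muln_gt0.
(* The default value is never taken on pairs from [S], as [fE] shows. *)
pose f (p : F * F) : 'I_(2 * K ^ 2) * 'I_(2 * (2 * K)) :=
  odflt (Ordinal h1, Ordinal h2) [pick i | (box_z i == z p) && (box_y i == y p)].
have fE p : (p.1 \in S) && (p.2 \in S) -> box_z (f p) = z p /\ box_y (f p) = y p.
  move=> /zyb[hz hy]; rewrite /f; case: pickP => /= [i /andP[/eqP -> /eqP ->] //|].
  by have [i iz iy] := box_point hz hy => /(_ i); rewrite iz iy !eqxx.
have inX p : (p \in finset.setX S S) = (p.1 \in S) && (p.2 \in S).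
  by case: p => x x'; rewrite finset.in_setX.
rewrite -[(rep A w ^ 2)%N]mulnn -cardsX -sum1_card (bigID (fun p => z p == 0)) /=.
apply: leq_add.
  rewrite sum1_card.
  have := @sum_fiber_le int (F * F)%type F
    (fun p => (p \in finset.setX S S) && (z p == 0)) (fun x => x \in S) fst (fun=> 1) 2.
  rewrite !sumr_const -natrM ler_nat; apply.
  - by move=> p; rewrite inE => /andP[/andP[]].
  - by [].
  move=> x _; have [x1 /eqP e1|E] := pickP (fun x' => s x' == - s x).
    apply: leq_trans (card_size [:: (x, x); (x, x1)]).
    apply/subset_leq_card/fintype.subsetP => -[u v] /andP[/andP[_ /eqP uv] /eqP /= ux].
    move: uv; rewrite /z /= ux => /eqP; rewrite subr_eq0 eqf_sqr => /orP[/eqP/s_inj <-|/eqP e2].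
      by rewrite !inE eqxx.
    have -> : v = x1 by apply: s_inj; rewrite e1 e2 opprK.
    by rewrite !inE eqxx orbT.
  apply: (@leq_trans 1) => //; apply: leq_trans (card_size [:: (x, x)]).
  apply/subset_leq_card/fintype.subsetP => -[u v] /andP[/andP[_ /eqP uv] /eqP /= ux].
  move: uv; rewrite /z /= ux => /eqP; rewrite subr_eq0 eqf_sqr => /orP[/eqP/s_inj <-|/eqP e2].
    by rewrite !inE eqxx.
  by have := E v; rewrite e2 opprK eqxx.
rewrite sum1_card.
have := @sum_fiber_le int (F * F)%type _
  (fun p => (p \in finset.setX S S) && (z p != 0)) (@box_lattice q (K ^ 2) (2 * K) (theta w))
  f (fun=> 1) (2 * D).
rewrite !sumr_const -natrM ler_nat; apply.
- move=> p /andP[]; rewrite inX => pS zp; have [hz hy] := zyb _ pS.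
  have [fz fy] := fE _ pS.
  by rewrite /box_lattice /box_pt fz fy hz hy zp /= rel.
- by [].
move=> j /andP[/and3P[zK _ z0] _].
(* Here [|z| < K ^ 2], which may exceed [q]; hence divisors are bounded up to [q ^ 2]. *)
apply: leq_trans (leq_mul (leqnn 2) (D_bound (_ : 0 < `|box_z j| < q ^ 2)%N)); last first.
  by rewrite absz_gt0 z0 (leq_trans zK) // leq_sqr; lia.
apply: leq_trans (card_diff_squares (mem S) s_inj z0).
apply/subset_leq_card/fintype.subsetP => p /andP[/andP[pS zp] /eqP fp].
rewrite inX in pS; have [fz _] := fE _ pS.
by rewrite inE pS -fp fz /z eqxx.
Qed.

(** The slope [theta w] fixes [w ^ 2], so at most two [w] share a lattice. *)
Lemma sum_box_mass_theta :
  \sum_(w | w != 0) @box_mass R q (K ^ 2) (2 * K) (theta w) <=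
  16 * K%:R ^+ 3 * harm_sum R (q ^ 2) ^+ 2.
Proof.
have two0 := Fp_two_neq0 q_pr q_odd.
have K2_gt0 : (0 < K ^ 2)%N by rewrite expn_gt0 K0.
have K20 : (0 < 2 * K)%N by rewrite muln_gt0.
have m0 (t : F) : 0 <= @box_mass R q (K ^ 2) (2 * K) t.
  by apply: sumr_ge0 => i _; apply: box_weight_ge0.
apply: (@le_trans _ _ (2 * \sum_t @box_mass R q (K ^ 2) (2 * K) t)).
  apply: (@sum_fiber_le _ _ _ _ predT (fun w : F => theta w)) => // t _.
  have [x /andP[x0 /eqP xt]|E] := pickP [pred w : F | (w != 0) && (theta w == t)]; last first.
    by rewrite eq_card0.
  apply: leq_trans (card_size [:: x; - x]).
  apply/subset_leq_card/fintype.subsetP => v /andP[v0 /eqP vt].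
  rewrite !inE -eqf_sqr; apply/eqP; apply: (mulfI two0); apply: invr_inj; apply: (mulfI b0).
  by rewrite vt -xt.
rewrite (_ : 16 * _ * _ = 2 * (4 * (K%:R ^+ 2 * (2 * K%:R)) * (harm_sum R (q ^ 2) ^+ 2))); last by ring.
apply: ler_wpM2l => //; apply: le_trans (sum_box_mass R q_pr K2_gt0 K20 Kq) _.
rewrite natrX natrM; apply: ler_wpM2l.
  by rewrite mulr_ge0 // mulr_ge0 // sqr_ge0.
have h0 n : 0 <= harm_sum R n by apply: sumr_ge0 => i _; rewrite invr_ge0.
by apply: ler_pM => //; apply: harm_sum_le; rewrite ?leq_sqr; nia.
Qed.

Lemma fourth_moment :
  \sum_(w | w != 0) (rep A w)%:R ^+ 4 <=
  D%:R ^+ 7 * harm_sum R (q ^ 2) ^+ 2 *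
  (K%:R ^+ 2 * Num.sqrt (K%:R ^+ 3 / q%:R) ^+ 3 + K%:R ^+ 3).
Proof.
set LG := harm_sum R (q ^ 2); set sg := Num.sqrt _.
have two0 := Fp_two_neq0 q_pr q_odd.
have qR : 0 < q%:R :> R by rewrite ltr0n prime_gt0.
have KR : 1 <= K%:R :> R by rewrite ler1n.
have sg0 : 0 <= sg by apply: sqrtr_ge0.
have sg2 : sg ^+ 2 = K%:R ^+ 3 / q%:R by rewrite sqr_sqrtr // divr_ge0 ?exprn_ge0.
have D100 : 100 <= D%:R :> R by rewrite ler_nat.
have D1 : 1 <= D%:R :> R by lra.
have LG1 : 1 <= LG.
  apply: le_trans (harm_sum_ge1 R q_pr) _; apply: harm_sum_le.
  by rewrite leq_pmulr // prime_gt0.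
pose m w := @box_mass R q (K ^ 2) (2 * K) (theta w).
have m0 w : 0 <= m w by apply: sumr_ge0 => i _; apply: box_weight_ge0.
pose r w : R := (rep A w)%:R.
(* The shape matters: a term linear in [r w] is summed by the first moment, and [m w] by
   [sum_box_mass_theta]. *)
have pointwise w : w != 0 ->
    r w ^+ 4 <= (D%:R ^+ 6 * sg ^+ 3 + 2 * D%:R) * r w + D%:R ^+ 4 * m w.
  move=> w0; have th0 : theta w != 0 by rewrite mulf_neq0 ?invr_eq0 ?mulf_neq0 ?expf_neq0.
  have K2_gt0 : (0 < K ^ 2)%N by rewrite expn_gt0 K0.
  have K20 : (0 < 2 * K)%N by rewrite muln_gt0.
  have := box_lattice_count R q_pr K2_gt0 K20 Kq th0; rewrite -/(m w).
  have := rep_sqr_le w0; rewrite -(ler_nat R) !(natrD, natrM, natrX) -/(r w).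
  set T : R := #|_|%:R => h1.
  rewrite (_ : K%:R ^+ 2 * _ / _ = 2 * sg ^+ 2) => [h2|]; last by rewrite sg2; ring.
  have r0 : 0 <= r w by [].
  have T0 : 0 <= T by [].
  move: (m w) (m0 w) h2 => mw mw0 h2.
  have Ds0 : 0 <= D%:R * sg by rewrite mulr_ge0.
  have h3 : r w ^+ 4 <= 27 * r w + 16 * D%:R ^+ 2 * T ^+ 2.
    have [r3|r4] := leqP (rep A w) 3.
      have {}r3 : r w <= 3 by rewrite /r (ler_nat _ _ 3).
      have : r w ^+ 3 <= 27.
        rewrite (_ : 27 = 3 ^+ 3) //; last by ring.
        by apply: lerXn2r; rewrite ?nnegrE.
      have : 0 <= 16 * D%:R ^+ 2 * T ^+ 2 by rewrite mulr_ge0 // mulr_ge0 // sqr_ge0.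
      by rewrite (exprSr _ 3); nra.
    have {}r4 : 4 <= r w by rewrite /r (ler_nat _ 4).
    (* For [r w >= 4] the term [2 * r w] is at most half of [r w ^+ 2]. *)
    have h4 : r w ^+ 2 <= 4 * D%:R * T by nra.
    have : (r w ^+ 2) ^+ 2 <= (4 * D%:R * T) ^+ 2.
      by apply: lerXn2r; rewrite ?nnegrE ?sqr_ge0 ?mulr_ge0.
    rewrite -exprM !exprMn => h5.
    by apply: le_trans h5 _; rewrite -[leLHS]add0r lerD ?mulr_ge0 // (_ : 4 ^+ 2 = 16) //; ring.
  have D2 : 0 <= D%:R ^+ 2 :> R by apply: sqr_ge0.
  have T2 : T ^+ 2 <= D%:R ^+ 2 * sg ^+ 4 + D%:R * mw.
    apply: le_trans h2 _; apply: lerD; last by rewrite ler_wpM2r //; lra.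
    rewrite (_ : 450 * _ = (450 * 4) * sg ^+ 4); last by ring.
    by rewrite ler_wpM2r ?exprn_ge0 //; nra.
  have h4 : r w ^+ 4 <= D%:R * r w + (D%:R ^+ 5 * sg ^+ 4 + D%:R ^+ 4 * mw) / 2.
    apply: le_trans h3 _; apply: lerD; first by rewrite ler_wpM2r //; lra.
    apply: (@le_trans _ _ (D%:R ^+ 3 / 2 * T ^+ 2)).
      by rewrite ler_wpM2r ?sqr_ge0 // exprS; nra.
    have := ler_wpM2l (_ : 0 <= D%:R ^+ 3 / 2) T2; rewrite divr_ge0 ?exprn_ge0 // => /(_ isT).
    by move/le_trans; apply; rewrite le_eqVlt; apply/orP; left; apply/eqP; field.
  (* If [r w] is large, the factor 1/2 in [h4] absorbs the area term into the left side. Otherwise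
     [r w <= D^2 sg], and three of the four factors [r w] are replaced by this bound, leaving one
     for the first moment. *)
  have [small|big] := leP (r w ^+ 4) (D%:R ^+ 5 * sg ^+ 4); last first.
    have : 0 <= D%:R ^+ 6 * sg ^+ 3 * r w by rewrite !mulr_ge0 ?exprn_ge0.
    by lra.
  have rt : r w <= D%:R ^+ 2 * sg.
    rewrite -(@ler_pXn2r _ 4) ?nnegrE ?mulr_ge0 //; apply: le_trans small _.
    rewrite exprMn -exprM; apply: ler_wpM2r; first by rewrite exprn_ge0.
    by rewrite ler_weXn2l.
  have h5 : r w ^+ 3 <= (D%:R ^+ 2 * sg) ^+ 3.
    by apply: lerXn2r; rewrite ?nnegrE ?mulr_ge0.
  have : r w ^+ 4 <= (D%:R ^+ 2 * sg) ^+ 3 * r w by rewrite exprSr ler_wpM2r.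
  rewrite exprMn -exprM.
  have : 0 <= D%:R ^+ 4 * mw by rewrite !mulr_ge0 ?exprn_ge0.
  have : 0 <= 2 * D%:R * r w by rewrite !mulr_ge0.
  by lra.
have sumr : \sum_(w | w != 0) r w <= 4 * K%:R ^+ 2.
  apply: (@le_trans _ _ (\sum_w r w)).
    by rewrite [leRHS](bigID (fun w => w != 0)) /= lerDl; apply: sumr_ge0.
  rewrite -natr_sum sum_rep -natrX -natrM ler_nat.
  by rewrite -[4%N]/(2 ^ 2)%N -expnMn leq_sqr card_sqrt_set.
apply: le_trans (ler_sum _ pointwise) _.
rewrite big_split /= -!mulr_sumr.
have c0 : 0 <= D%:R ^+ 6 * sg ^+ 3 + 2 * D%:R by rewrite addr_ge0 ?mulr_ge0 ?exprn_ge0.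
have := ler_wpM2l c0 sumr.
have := ler_wpM2l (_ : 0 <= D%:R ^+ 4) sum_box_mass_theta; rewrite exprn_ge0 // -/LG.
move=> /(_ isT) h1 h2; apply: le_trans (lerD h2 h1) _.
have L2 : 1 <= LG ^+ 2 by rewrite exprn_ege1.
have K3 : K%:R ^+ 2 <= K%:R ^+ 3 :> R by rewrite ler_weXn2l.
have Ks : 0 <= K%:R ^+ 2 * sg ^+ 3 by rewrite mulr_ge0 ?exprn_ge0.
have D6 : 4 * D%:R ^+ 6 <= D%:R ^+ 7 :> R.
  by rewrite (exprS _ 6); apply: ler_wpM2r; [rewrite exprn_ge0 | lra].
have D5 : D%:R + D%:R ^+ 4 <= 2 * D%:R ^+ 6 :> R.
  have e1 : D%:R <= D%:R ^+ 6 :> R by rewrite -[leLHS]expr1 ler_weXn2l.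
  have e2 : D%:R ^+ 4 <= D%:R ^+ 6 :> R by rewrite ler_weXn2l.
  lra.
have D67 : 32 * D%:R ^+ 6 <= D%:R ^+ 7 :> R.
  by rewrite (exprS _ 6); apply: ler_wpM2r; [rewrite exprn_ge0 | lra].
have D40 : 0 <= D%:R ^+ 4 :> R by rewrite exprn_ge0.
have D60 : 0 <= D%:R ^+ 6 :> R by rewrite exprn_ge0.
have D70 : 0 <= D%:R ^+ 7 :> R by rewrite exprn_ge0.
have K30 : 0 <= K%:R ^+ 3 :> R by rewrite exprn_ge0.
have t1 : 4 * D%:R ^+ 6 * (K%:R ^+ 2 * sg ^+ 3) <=
    D%:R ^+ 7 * LG ^+ 2 * (K%:R ^+ 2 * sg ^+ 3).
  by rewrite ler_wpM2r // (le_trans D6) // ler_peMr.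
have t2 : 8 * D%:R * K%:R ^+ 2 <= 8 * D%:R * (K%:R ^+ 3 * LG ^+ 2).
  by rewrite ler_wpM2l ?mulr_ge0 // (le_trans K3) // ler_peMr.
have t3 : 16 * (D%:R + D%:R ^+ 4) * (K%:R ^+ 3 * LG ^+ 2) <=
    D%:R ^+ 7 * (K%:R ^+ 3 * LG ^+ 2).
  by rewrite ler_wpM2r ?mulr_ge0 ?sqr_ge0 //; lra.
have t4 : 0 <= D%:R * (K%:R ^+ 3 * LG ^+ 2) by rewrite mulr_ge0 // mulr_ge0 // sqr_ge0.
by lra.
Qed.

End FourthMoment.

(** * Bilinear forms with additive characters *)

Section BilinearForms.
Variables (R : realType) (q : nat).
Hypothesis q_pr : prime q.
Local Notation F := ('F_q).
Local Notation psi := (@addchar R q).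
Local Notation conj := (@conjc R).
Implicit Types U V : {set F}.

Definition expsum U (l : F) : R[i] := \sum_(u in U) psi (u * l).

Lemma sum_differences (M : nmodType) U (g : F -> M) :
  \sum_(u in U) \sum_(u' in U) g (u - u') = \sum_w g w *+ rep U w.
Proof.
transitivity (\sum_(u in U) \sum_w (if u - w \in U then g w else 0)).
  apply: eq_bigr => u _; rewrite big_mkcond [LHS](reindex_inj (subrI u)) /=.
  by apply: eq_bigr => w _; rewrite subKr.
rewrite exchange_big /=; apply: eq_bigr => w _; rewrite -big_mkcondr /= sumr_const.
by congr (_ *+ _); apply: eq_card => u; rewrite !inE.
Qed.

Lemma expsum_sqr U l :
  real_complex R (cabs (expsum U l) ^+ 2) = \sum_w (rep U w)%:R * psi (w * l).
Proof.
rewrite cabs_sqr conj_sum mulr_suml.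
under [RHS]eq_bigr => w _ do rewrite mulr_natl.
rewrite -[RHS](sum_differences U (fun w => psi (w * l))).
apply: eq_bigr => u _; rewrite mulr_sumr; apply: eq_bigr => u' _.
by rewrite conj_addchar // -addcharD // mulrBl.
Qed.

(** The squared modulus of [expsum U] is the Fourier transform of [rep U], so this is Parseval. *)
Lemma expsum_fourth_moment U :
  \sum_l cabs (expsum U l) ^+ 4 = q%:R * \sum_w (rep U w)%:R ^+ 2.
Proof.
have cabs_nat n : cabs (n%:R : R[i]) = n%:R.
  by rewrite -(rmorph_nat (real_complex R)) cabs_real.
under [in RHS]eq_bigr => w _ do rewrite -cabs_nat.
rewrite -(parseval q_pr (fun w => (rep U w)%:R)).
apply: eq_bigr => l _; rewrite -expsum_sqr cabs_real ?sqr_ge0 // -exprM.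
by [].
Qed.

Lemma expsum0 U : cabs (expsum U 0) = #|U|%:R.
Proof.
rewrite /expsum (eq_bigr (fun=> 1)) => [|u _]; last by rewrite mulr0 addchar0.
by rewrite sumr_const -(rmorph_nat (real_complex R)) cabs_real.
Qed.

Variables (U V : {set F}) (al be : F -> R[i]) (k : F) (bi : R).
Hypotheses (k0 : k != 0) (bi_bound : forall v, v \in V -> cabs (be v) <= bi).

Let B1 : R := \sum_(v in V) cabs (be v).
Let offpair (p : F * F) := [&& p.1 \in V, p.2 \in V & p.1 != p.2].
Let wt (p : F * F) : R := cabs (be p.1) * cabs (be p.2).
Let X (p : F * F) : R := cabs (expsum U (k * (p.1 - p.2))).
Let Off : R := \sum_(p | offpair p) wt p * X p.

Let X_ge0 p : 0 <= X p. Proof. exact: cabs_ge0. Qed.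
Let wt_ge0 p : 0 <= wt p. Proof. by rewrite mulr_ge0 ?cabs_ge0. Qed.
Let Off_ge0 : 0 <= Off. Proof. by apply: sumr_ge0 => p _; rewrite mulr_ge0. Qed.
Let B1_ge0 : 0 <= B1. Proof. by apply: sumr_ge0 => v _; apply: cabs_ge0. Qed.

(** Cauchy-Schwarz in [u] removes [al]. After expansion the pairs [v = v'] contribute [#|U|] times
    the sum of [|be v|^2], at most [bi * B1]; the rest is [Off]. *)
Lemma bilinear_sqr_le :
  cabs (\sum_(u in U) \sum_(v in V) al u * be v * psi (k * u * v)) ^+ 2 <=
  (\sum_(u in U) cabs (al u) ^+ 2) * (#|U|%:R * bi * B1 + Off).
Proof.
pose Bu u := \sum_(v in V) be v * psi (k * u * v).
rewrite (eq_bigr (fun u => al u * Bu u)) => [|u _]; last first.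
  by rewrite mulr_sumr; apply: eq_bigr => v _; rewrite mulrA.
apply: (@le_trans _ _ ((\sum_(u in U) cabs (al u) * cabs (Bu u)) ^+ 2)).
  apply: lerXn2r; rewrite ?nnegrE ?cabs_ge0 //.
    by apply: sumr_ge0 => u _; rewrite mulr_ge0 ?cabs_ge0.
  by apply: le_trans (cabs_sum _ _ _) _; apply: ler_sum => u _; rewrite cabsM.
apply: le_trans (sum_CS _ _ _) _; apply: ler_wpM2l.
  by apply: sumr_ge0 => u _; apply: sqr_ge0.
have S0 : 0 <= \sum_(u in U) cabs (Bu u) ^+ 2 by apply: sumr_ge0 => u _; apply: sqr_ge0.
rewrite -(cabs_real S0).
have -> : real_complex R (\sum_(u in U) cabs (Bu u) ^+ 2) =
    \sum_(v in V) \sum_(v' in V) be v * conj (be v') * expsum U (k * (v - v')).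
  rewrite rmorph_sum /=.
  transitivity (\sum_(u in U) \sum_(v in V) \sum_(v' in V)
      be v * conj (be v') * psi (u * (k * (v - v')))).
    apply: eq_bigr => u _; rewrite cabs_sqr conj_sum mulr_suml; apply: eq_bigr => v _.
    rewrite mulr_sumr; apply: eq_bigr => v' _.
    rewrite conjM conj_addchar // mulrACA -addcharD // -mulrN -mulrDr.
    by congr (_ * psi _); rewrite mulrA [u * k]mulrC.
  rewrite exchange_big /=; apply: eq_bigr => v _.
  rewrite exchange_big /=; apply: eq_bigr => v' _.
  by rewrite mulr_sumr.
apply: (@le_trans _ _ (\sum_(v in V) \sum_(v' in V) wt (v, v') * X (v, v'))).
  apply: le_trans (cabs_sum _ _ _) _; apply: ler_sum => v _.
  apply: le_trans (cabs_sum _ _ _) _; apply: ler_sum => v' _.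
  by rewrite !cabsM cabsJ.
rewrite pair_big /= (bigID (fun p => p.1 == p.2)) /=; apply: lerD; last first.
  rewrite le_eqVlt; apply/orP; left; apply/eqP; apply: eq_big => [p|[v v'] _ //].
  by rewrite /offpair andbA.
rewrite /B1 mulr_sumr.
rewrite (reindex_onto (fun v => (v, v)) fst) /=; last first.
  by move=> [v v'] /andP[_ /eqP /= ->].
rewrite (eq_bigl (fun v => v \in V)); last by move=> v; rewrite !eqxx !andbT andbb.
apply: ler_sum => v vV; rewrite /wt /X /= subrr mulr0 expsum0 mulrC -mulrA.
rewrite ler_wpM2l //; apply: ler_wpM2r; first exact: cabs_ge0.
exact: bi_bound.
Qed.

Let sum_wt : \sum_(p | offpair p) wt p <= B1 ^+ 2.
Proof.
rewrite expr2 mulr_suml.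
rewrite (eq_bigr (fun v => \sum_(v' in V) wt (v, v'))) => [|v _]; last by rewrite mulr_sumr.
rewrite pair_big /= [leRHS](bigID offpair) /=.
rewrite [X in _ <= X + _](eq_big offpair wt) => [|p|[v v'] //].
  by rewrite lerDl; apply: sumr_ge0 => -[v v'] _.
by rewrite /offpair /=; case: (_ \in _); case: (_ \in _).
Qed.

Let sum_wtX n : \sum_(p | offpair p) wt p * X p ^+ n <=
  bi ^+ 2 * \sum_(w | w != 0) (rep V w)%:R * cabs (expsum U (k * w)) ^+ n.
Proof.
apply: (@le_trans _ _ (\sum_(p | offpair p) bi ^+ 2 * X p ^+ n)).
  apply: ler_sum => -[v v'] /and3P[/= vV v'V _].
  rewrite ler_wpM2r ?exprn_ge0 // expr2.
  by apply: ler_pM; rewrite ?cabs_ge0 ?bi_bound.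
rewrite -mulr_sumr; apply: ler_wpM2l; first exact: sqr_ge0.
have := sum_differences V (fun w => if w == 0 then 0 else cabs (expsum U (k * w)) ^+ n).
rewrite pair_big /= => E.
rewrite le_eqVlt; apply/orP; left; apply/eqP.
transitivity (\sum_(p | (p.1 \in V) && (p.2 \in V))
    (if p.1 - p.2 == 0 then 0 else cabs (expsum U (k * (p.1 - p.2))) ^+ n)).
  rewrite [RHS](bigID (fun p => p.1 != p.2)) /= [X in _ + X]big1 ?addr0; last first.
    by move=> [v v'] /= /andP[_ /negPn/eqP ->]; rewrite subrr eqxx.
  apply: eq_big => [p|[v v'] /and3P[_ _ /= vv']]; first by rewrite /offpair andbA.
  by rewrite subr_eq0 (negPf vv').
rewrite E [RHS]big_mkcond /=; apply: eq_bigr => w _.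
by case: eqP => _; rewrite ?mul0rn // mulr_natl.
Qed.

Let sum_expsum4 :
  \sum_(w | w != 0) cabs (expsum U (k * w)) ^+ 4 <= q%:R * \sum_w (rep U w)%:R ^+ 2.
Proof.
rewrite -expsum_fourth_moment [leRHS](reindex_inj (mulfI k0)) /=.
by rewrite [leRHS](bigID (fun w => w != 0)) /= lerDl; apply: sumr_ge0 => w _; rewrite exprn_ge0 ?cabs_ge0.
Qed.

Let E4 : R := \sum_(w | w != 0) (rep V w)%:R ^+ 4.
Let E2 : R := \sum_w (rep U w)%:R ^+ 2.

(** Hoelder over the pairs, weighted by [wt], raises [X] to the power 4 or 3. In the first case
    [rmax] leaves a pure fourth moment of [expsum U]; in the second [mixed_power4] separates [rep V]
    from it, and clearing the roots gives the twelfth power. *)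
Lemma bilinear_bound (rmax : R) : (forall w, w != 0 -> (rep V w)%:R <= rmax) ->
  exists2 off, 0 <= off &
  [/\ cabs (\sum_(u in U) \sum_(v in V) al u * be v * psi (k * u * v)) ^+ 2 <=
        (\sum_(u in U) cabs (al u) ^+ 2) *
        (#|U|%:R * bi * (\sum_(v in V) cabs (be v)) + off),
      off ^+ 4 <= (\sum_(v in V) cabs (be v)) ^+ 6 * bi ^+ 2 *
        (rmax * (q%:R * \sum_w (rep U w)%:R ^+ 2)) &
      off ^+ 12 <= (\sum_(v in V) cabs (be v)) ^+ 16 * bi ^+ 8 *
        ((\sum_(w | w != 0) (rep V w)%:R ^+ 4) *
         (q%:R * \sum_w (rep U w)%:R ^+ 2) ^+ 3)].
Proof.
move=> hr; exists Off => //; split; first exact: bilinear_sqr_le.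
- rewrite -/B1.
  apply: le_trans (weighted_power4 _ _) _; first by move=> p _; apply: wt_ge0.
  rewrite -mulrA (exprM _ 2 3); apply: ler_pM.
  + by rewrite exprn_ge0 // sumr_ge0.
  + by apply: sumr_ge0 => p _; rewrite mulr_ge0 ?exprn_ge0.
  + by apply: lerXn2r; rewrite ?nnegrE ?sqr_ge0 ?sum_wt // sumr_ge0.
  apply: le_trans (sum_wtX 4) _; apply: ler_wpM2l; first exact: sqr_ge0.
  have c0 w : 0 <= cabs (expsum U (k * w)) ^+ 4 by rewrite exprn_ge0 ?cabs_ge0.
  apply: (@le_trans _ _ (rmax * \sum_(w | w != 0) cabs (expsum U (k * w)) ^+ 4)).
    by rewrite mulr_sumr; apply: ler_sum => w w0; rewrite ler_wpM2r ?hr.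
  apply: ler_wpM2l; last exact: sum_expsum4.
  (* Evaluating the bound at the nonzero element 1 shows [rmax >= 0]. *)
  by apply: le_trans (hr 1 (oner_neq0 _)).
rewrite -/B1 -/E4 -/E2.
pose Q3 : R := \sum_(w | w != 0) (rep V w)%:R * cabs (expsum U (k * w)) ^+ 3.
have Q30 : 0 <= Q3 by apply: sumr_ge0 => w _; rewrite mulr_ge0 ?exprn_ge0 ?cabs_ge0.
have h1 : Off ^+ 3 <= B1 ^+ 4 * bi ^+ 2 * Q3.
  apply: le_trans (weighted_power3 _ _) _; [by move=> p _; apply: wt_ge0|by move=> p _|].
  rewrite -mulrA (exprM _ 2 2); apply: ler_pM.
  + by rewrite exprn_ge0 // sumr_ge0.
  + by apply: sumr_ge0 => p _; rewrite mulr_ge0 ?exprn_ge0.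
  + by apply: lerXn2r; rewrite ?nnegrE ?sqr_ge0 ?sum_wt // sumr_ge0.
  exact: sum_wtX 3.
have h2 : Q3 ^+ 4 <= E4 * (q%:R * E2) ^+ 3.
  apply: le_trans (mixed_power4 _ _) _ => [w _|w _|]; [by []|exact: cabs_ge0|].
  apply: ler_wpM2l; first by apply: sumr_ge0 => w _; rewrite exprn_ge0.
  apply: lerXn2r; rewrite ?nnegrE.
  + by apply: sumr_ge0 => w _; rewrite exprn_ge0 ?cabs_ge0.
  + by rewrite mulr_ge0 // sumr_ge0 // => w _; rewrite exprn_ge0.
  exact: sum_expsum4.
have h3 : (Off ^+ 3) ^+ 4 <= (B1 ^+ 4 * bi ^+ 2 * Q3) ^+ 4.
  apply: lerXn2r h1; rewrite nnegrE; first by rewrite exprn_ge0.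
  apply: mulr_ge0 => //; apply: mulr_ge0; [by rewrite exprn_ge0 | exact: sqr_ge0].
rewrite (exprM _ 3 4); apply: le_trans h3 _.
rewrite (_ : (B1 ^+ 4 * _ * _) ^+ 4 = B1 ^+ 16 * bi ^+ 8 * Q3 ^+ 4); last by ring.
apply: ler_wpM2l h2.
by apply: mulr_ge0; [rewrite exprn_ge0 | rewrite (exprM bi 4 2) sqr_ge0].
Qed.

End BilinearForms.

(** * Splitting into square classes *)

Section SquareClasses.
Variables (q : nat).
Hypotheses (q_pr : prime q) (q_odd : odd q).
Local Notation F := ('F_q).

Definition nsqrt (c : F) : nat := #|[pred u : F | u ^+ 2 == c]|.

Lemma nsqrt_le2 c : (nsqrt c <= 2)%N.
Proof.
rewrite /nsqrt; have [x /eqP xc|E] := pickP [pred u : F | u ^+ 2 == c]; last by rewrite eq_card0.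
apply: leq_trans (card_size [:: x; - x]); apply/subset_leq_card/fintype.subsetP => y.
by rewrite !inE -eqf_sqr xc.
Qed.

(** Squaring identifies 1 and -1, which differ for odd [q]; not being injective on a finite set, it
    is not surjective. *)
Lemma exists_nonsquare : exists g : F, forall x, x ^+ 2 != g.
Proof.
have [g hg|H] := pickP [pred g : F | [forall x : F, x ^+ 2 != g]].
  by exists g => x; move/forallP: hg; apply.
have surj (g : F) : exists x, x ^+ 2 == g.
  by have := H g => /negbT; rewrite negb_forall => /existsP[x]; rewrite negbK; exists x.
pose f g := xchoose (surj g).
have fK : cancel f (fun x => x ^+ 2) by move=> g; apply/eqP/(xchooseP (surj g)).
have inj : injective (fun x : F => x ^+ 2).
  exact: bij_inj (bij_can_bij (injF_bij (can_inj fK)) fK).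
have two0 := Fp_two_neq0 q_pr q_odd.
have /eqP := inj 1 (-1) (esym (sqrrN 1)).
by rewrite -subr_eq0 opprK (negPf two0).
Qed.

(* With g a nonsquare at most one of c and g c is a square, so no term exceeds 2,
   while the average over c <> 0 is 2. *)
Lemma square_classes : exists2 g : F, g != 0 &
  forall c, c != 0 -> (nsqrt c + nsqrt (g * c)%R = 2)%N.
Proof.
have [g gN] := exists_nonsquare; have g0 : g != 0.
  by apply: contraTneq (gN 0) => ->; rewrite expr0n negbK.
exists g => //.
have le2 c : c != 0 -> (nsqrt c + nsqrt (g * c)%R <= 2)%N.
  move=> c0; have [x /eqP xc|E] := pickP [pred u : F | u ^+ 2 == c]; last first.
    by rewrite {1}/nsqrt eq_card0 // add0n nsqrt_le2.
  rewrite (_ : nsqrt (g * c)%R = 0)%N ?addn0 ?nsqrt_le2 //.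
  apply: eq_card0 => y; rewrite !inE; apply: contraTF (gN (y / x)) => /eqP yc.
  by rewrite negbK exprMn exprVn xc yc mulfK.
have total (h : F) : h != 0 -> (\sum_(c : F | c != 0%R) nsqrt (h * c)%R = \sum_(x : F | x != 0%R) 1)%N.
  move=> h0; rewrite [RHS](partition_big (fun x : F => x ^+ 2 / h) (fun c => c != 0)) /=; last first.
    by move=> x x0; rewrite mulf_neq0 ?invr_eq0 ?expf_neq0.
  apply: eq_bigr => c c0; rewrite sum1_card; apply: eq_card => x.
  rewrite !inE -[RHS]/((x != 0) && (x ^+ 2 / h == c)).
  have -> : (x ^+ 2 / h == c) = (x ^+ 2 == h * c).
    by rewrite -(inj_eq (mulIf h0)) divfK // [c * h]mulrC.
  by case: (eqVneq x 0) => //= ->; rewrite expr0n /= eq_sym mulf_eq0 (negPf h0) (negPf c0).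
have eqs : (\sum_(c : F | c != 0%R) (nsqrt c + nsqrt (g * c)%R) = \sum_(c : F | c != 0%R) 2)%N.
  rewrite big_split /= total //.
  have -> : (\sum_(c : F | c != 0%R) nsqrt c = \sum_(x : F | x != 0%R) 1)%N.
    by rewrite -(total 1 (oner_neq0 _)); apply: eq_bigr => c _; rewrite mul1r.
  by rewrite -big_split.
move=> c c0; apply/eqP; rewrite eqn_leq le2 //= leqNgt; apply/negP => lt.
have : (\sum_(c : F | c != 0%R) (nsqrt c + nsqrt (g * c)%R) < \sum_(c : F | c != 0%R) 2)%N.
  rewrite (bigD1 c) //= [X in (_ < X)%N](bigD1 c) //= -addSn leq_add //.
  by apply: leq_sum => d /andP[d0 _]; apply: le2.
by rewrite eqs ltnn.
Qed.

(** Since [2 * K <= q], each [m < 2 * K] is its own residue, so the roots are sorted by [m] without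
    collision. *)
Lemma sum_sqrt_set (M : nmodType) (b : F) (K : nat) (G : nat -> F -> M) : b != 0 ->
    (2 * K <= q)%N ->
  \sum_(u in sqrt_set b K) G (sqrt_index b u) u =
  \sum_(K <= m < 2 * K) \sum_(u : F | u ^+ 2 == b * m%:R) G m u.
Proof.
move=> b0 Kq; rewrite big_geq_mkord /=.
have [->|K0] := posnP K.
  by rewrite !big1 //= => [[]|u] //; rewrite inE ltn0 andbF.
have K20 : (0 < 2 * K)%N by rewrite muln_gt0.
pose f (x : F) : 'I_(2 * K) := insubd (Ordinal K20) (sqrt_index b x).
have fE x : x \in sqrt_set b K -> f x = sqrt_index b x :> nat.
  by rewrite inE => /andP[_ h]; rewrite /f val_insubd h.
rewrite (partition_big f (fun m : 'I_(2 * K) => (K <= m)%N)) /=; last first.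
  by move=> x xA; rewrite fE //; move: xA; rewrite inE => /andP[].
apply: eq_bigr => m Km; apply: eq_big => [u|u /andP[uA /eqP um]].
  apply/andP/eqP => [[uA /eqP um]|um].
    by rewrite -(sqrt_indexE u b0) -um fE.
  have uA : sqrt_index b u = m.
    rewrite /sqrt_index um mulrAC divff // mul1r val_Fp_nat // modn_small //.
    exact: leq_trans (ltn_ord m) Kq.
  have uA' : u \in sqrt_set b K by rewrite inE uA Km ltn_ord.
  by split=> //; apply/eqP/val_inj; rewrite /= fE.
by rewrite -fE // um.
Qed.

Lemma natr_Fp_eq m n : ((m%:R : F) == n%:R) = (m == n %[mod q])%N.
Proof.
apply/eqP/eqP => [/(congr1 (@nat_of_ord _))|E].
  by rewrite /= !val_Fp_nat.
by apply: val_inj; rewrite /= !val_Fp_nat.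
Qed.

Variable (R : realType).
Local Notation psi := (@addchar R q).

(** The substitution [x = u v / j], with inverse [v = j x / u]. *)
Lemma sum_factor_sqrt (c1 c2 h j u : F) : j != 0 -> u != 0 -> u ^+ 2 = j * c1 ->
  \sum_(v : F | v ^+ 2 == j * c2) psi (h / j * u * v) =
  \sum_(x : F | x ^+ 2 == c1 * c2) psi (h * x).
Proof.
move=> j0 u0 uc.
have c10 : c1 != 0 by apply: contraNneq u0 => c10; rewrite -sqrf_eq0 uc c10 mulr0.
rewrite [RHS](reindex_onto (fun v => u * v / j) (fun x => j * x / u)) /=; last first.
  by move=> x _; rewrite mulrA mulrC !mulrA; field; rewrite u0 j0.
apply: eq_big => [v|v _]; last by congr psi; field.
have -> : (j * (u * v / j) / u == v) = true by apply/eqP; field; rewrite u0 j0.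
rewrite andbT.
have -> : (u * v / j) ^+ 2 = (c1 / j) * v ^+ 2.
  by rewrite !exprMn uc exprVn; field.
have e : c1 / j != 0 by rewrite mulf_neq0 ?invr_eq0.
rewrite -(inj_eq (mulfI e)); congr (_ == _).
by rewrite mulrA divfK // mulrC.
Qed.

Variables (a h M N : nat) (alpha beta : nat -> R[i]).
Hypotheses (a_bd : (0 < a < q)%N) (h_bd : (0 < h < q)%N).
Hypotheses (Mq : (2 * M <= q)%N) (Nq : (2 * N <= q)%N) (M0 : (0 < M)%N).

Definition Wpart (j : F) : R[i] :=
  \sum_(u in sqrt_set (j * a%:R) M) \sum_(v in sqrt_set j N)
    alpha (sqrt_index (j * a%:R) u) * beta (sqrt_index j v) * psi (h%:R / j * u * v).

(** The inner sum does not depend on which root [u] of [j a m] is used, so only the number of such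
    roots remains. *)
Lemma Wpart_expand j : j != 0 ->
  Wpart j = \sum_(M <= m < 2 * M) \sum_(N <= n < 2 * N) alpha m * beta n *
    (\sum_(x : F | x ^+ 2 == a%:R * m%:R * n%:R) psi (h%:R * x)) *+ nsqrt (j * (a%:R * m%:R)).
Proof.
move=> j0; have a0 : a%:R != 0 :> F by apply: Fp_nat_neq0.
have ja0 : j * a%:R != 0 by rewrite mulf_neq0.
rewrite /Wpart (sum_sqrt_set (fun m u => \sum_(v in sqrt_set j N)
    alpha m * beta (sqrt_index j v) * psi (h%:R / j * u * v)) ja0 Mq).
apply: eq_big_nat => m /andP[Mm mM].
have m0 : m%:R != 0 :> F by apply: (Fp_nat_neq0 q_pr); apply/andP; split; lia.
transitivity (\sum_(u : F | u ^+ 2 == j * (a%:R * m%:R)) \sum_(N <= n < 2 * N)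
    alpha m * beta n * (\sum_(x : F | x ^+ 2 == a%:R * m%:R * n%:R) psi (h%:R * x))).
  rewrite (eq_bigl (fun u : F => u ^+ 2 == j * (a%:R * m%:R))); last by move=> u; rewrite mulrA.
  apply: eq_bigr => u /eqP uE.
  rewrite (sum_sqrt_set (fun n v => alpha m * beta n * psi (h%:R / j * u * v)) j0 Nq).
  apply: eq_bigr => n _; rewrite -mulr_sumr; congr (_ * _).
  apply: sum_factor_sqrt => //; rewrite -sqrf_eq0 uE !mulf_neq0 //.
by rewrite exchange_big /=; apply: eq_bigr => n _; rewrite sumr_const mulrnAr.
Qed.

Lemma Wsum_Wpart : exists2 g : F, g != 0 & Wsum q a h M N alpha beta *+ 2 = Wpart 1 + Wpart g.
Proof.
have [g g0 hg] := square_classes; exists g => //.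
rewrite !Wpart_expand ?oner_neq0 // -big_split /= /Wsum -sumrMnl.
apply: eq_big_nat => m /andP[Mm mM].
rewrite -big_split /= -sumrMnl; apply: eq_bigr => n _.
have am0 : a%:R * m%:R != 0 :> F.
  by rewrite mulf_neq0 // (Fp_nat_neq0 q_pr) //; apply/andP; split; lia.
rewrite -mulrnDr mul1r hg //; congr (_ * _ *+ _).
rewrite (eq_bigr (fun x : 'I_q => psi (h%:R * (x : nat)%:R))); last first.
  by move=> x _; rewrite -natrM addchar_nat.
rewrite -(@sum_Fp_nat q q_pr _ (fun x => (x ^ 2 == a * m * n %[mod q])%N)
  (fun x => psi (h%:R * x%:R))).
apply: eq_big => [x|x _]; last by rewrite natr_Zp.
by rewrite -natr_Fp_eq natrX !natrM natr_Zp.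
Qed.

End SquareClasses.

(** * Energy bounds *)

Section EnergyBounds.
Variables (R : realType) (q : nat).
Hypotheses (q_pr : prime q) (q_odd : odd q).
Local Notation F := ('F_q).
Variables (D : nat).
Hypothesis D_bound : forall z, (0 < z < q ^ 2)%N -> (size (divisors z) <= D)%N.
Hypothesis D_ge : (100 <= D)%N.

(** The harmonic sum goes up to [q ^ 2] because the lattice box has a side [K ^ 2]. As [D >= 100],
    powers of [loss] also swallow numerical constants. *)
Definition loss : R := D%:R * harm_sum R (q ^ 2).
Local Notation Lam := loss.

Let qR : 0 < q%:R :> R. Proof. by rewrite ltr0n prime_gt0. Qed.
Let DR : 100 <= D%:R :> R. Proof. by rewrite ler_nat. Qed.
Let hs_ge1 : 1 <= harm_sum R q. Proof. exact: harm_sum_ge1. Qed.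
Let hs_le : harm_sum R q <= harm_sum R (q ^ 2).
Proof. by apply: harm_sum_le; rewrite leq_pmulr // prime_gt0. Qed.

Lemma loss_ge : 100 <= Lam.
Proof. by rewrite -[100]mulr1; apply: ler_pM => //; apply: le_trans hs_ge1 hs_le. Qed.

Let Lam0 : 0 <= Lam. Proof. by apply: le_trans loss_ge. Qed.

Section OneSet.
Variables (b : F) (K : nat).
Hypotheses (b0 : b != 0) (K0 : (0 < K)%N) (Kq : (2 * K <= q)%N).
Local Notation A := (sqrt_set b K).
Let KR : 1 <= K%:R :> R. Proof. by rewrite ler1n. Qed.

Lemma rep_le w : w != 0 ->
  (rep A w)%:R <= Lam ^+ 3 * (K%:R ^+ 2 / q%:R + Num.sqrt K%:R).
Proof.
move=> w0; apply: (le_trans (rep_pointwise q_pr q_odd b0 w0 R (D := D) _ K0)).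
  move=> z /andP[z0 zq]; apply: D_bound; rewrite z0 (leq_trans zq) //.
  by rewrite leq_pmulr // prime_gt0.
have x0 : 0 <= K%:R ^+ 2 / q%:R :> R by rewrite divr_ge0 ?sqr_ge0.
have s0 := sqrtr_ge0 (K%:R : R).
have hL : Num.sqrt (D%:R * harm_sum R q) <= Lam.
  rewrite -[leRHS]ger0_norm // -sqrtr_sqr ler_wsqrtr // expr2.
  apply: (@le_trans _ _ Lam); first by rewrite ler_wpM2l.
  by rewrite ler_peMr //; have := loss_ge; lra.
rewrite -mulrA sqrtrM ?(le_trans _ KR) //.
have L2 : 128 <= Lam ^+ 2 by have := loss_ge; nra.
have hs : Num.sqrt K%:R * Num.sqrt (D%:R * harm_sum R q) <= Lam * Num.sqrt K%:R.
  by rewrite mulrC ler_wpM2r.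
rewrite (exprSr _ 2) -mulrA; apply: ler_pM; [exact: ler0n| |exact: L2|].
  by rewrite addr_ge0 // mulr_ge0 ?sqrtr_ge0.
rewrite mulrDr; apply: lerD => //.
by rewrite ler_peMl //; have := loss_ge; lra.
Qed.

Lemma sum_rep_le : \sum_(w | w != 0) (rep A w)%:R <= 4 * K%:R ^+ 2 :> R.
Proof.
apply: (@le_trans _ _ (\sum_w (rep A w)%:R)).
  by rewrite [leRHS](bigID (fun w => w != 0)) /= lerDl; apply: sumr_ge0.
rewrite -natr_sum sum_rep -natrX -natrM ler_nat.
by rewrite -[4%N]/(2 ^ 2)%N -expnMn leq_sqr card_sqrt_set.
Qed.

Let rep0_le : (rep A 0)%:R <= 2 * K%:R :> R.
Proof. by rewrite rep0 -natrM ler_nat card_sqrt_set. Qed.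

Let energy_split : \sum_w (rep A w)%:R ^+ 2 =
  (rep A 0)%:R ^+ 2 + \sum_(w | w != 0) (rep A w)%:R ^+ 2 :> R.
Proof. by rewrite (bigD1 0). Qed.

Lemma energy_le : \sum_w (rep A w)%:R ^+ 2 <=
  Lam ^+ 4 * (K%:R ^+ 2 * (K%:R ^+ 2 / q%:R + Num.sqrt K%:R)).
Proof.
set X := K%:R ^+ 2 / q%:R + Num.sqrt K%:R.
have X1 : 1 <= X.
  rewrite -[1]add0r; apply: lerD; first by rewrite divr_ge0 ?sqr_ge0.
  by have := ler_wsqrtr KR; rewrite sqrtr1.
have L := loss_ge.
rewrite energy_split.
have h1 : (rep A 0)%:R ^+ 2 <= 4 * K%:R ^+ 2 :> R.
  by rewrite (_ : 4 * _ = (2 * K%:R) ^+ 2); [apply: lerXn2r; rewrite ?nnegrE | ring].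
have h2 : \sum_(w | w != 0) (rep A w)%:R ^+ 2 <= Lam ^+ 3 * X * (4 * K%:R ^+ 2).
  apply: (@le_trans _ _ (\sum_(w | w != 0) Lam ^+ 3 * X * (rep A w)%:R)).
    by apply: ler_sum => w w0; rewrite expr2 ler_wpM2r // rep_le.
  by rewrite -mulr_sumr ler_wpM2l ?sum_rep_le // mulr_ge0 ?exprn_ge0 //; lra.
have K2 : 0 <= K%:R ^+ 2 :> R by apply: sqr_ge0.
have L3 : 1 <= Lam ^+ 3 by rewrite exprn_ege1 //; lra.
have h3 : 4 * K%:R ^+ 2 <= Lam ^+ 3 * X * (4 * K%:R ^+ 2).
  by rewrite ler_peMl ?mulr_ge0 // mulr_ege1.
have h4 : 0 <= Lam ^+ 3 * X * K%:R ^+ 2 by apply: mulr_ge0 => //; apply: mulr_ge0; lra.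
have := ler_wpM2r h4 L; rewrite (exprS _ 3); lra.
Qed.

Local Notation Q := (K%:R ^+ 2 * Num.sqrt (K%:R ^+ 3 / q%:R) ^+ 3 + K%:R ^+ 3 : R).

Lemma fourth_moment_le : \sum_(w | w != 0) (rep A w)%:R ^+ 4 <= Lam ^+ 7 * Q.
Proof.
apply: le_trans (fourth_moment R q_pr q_odd D_bound b0 K0 Kq D_ge) _.
have LG1 : 1 <= harm_sum R (q ^ 2) by apply: le_trans hs_ge1 hs_le.
apply: ler_wpM2r.
  by rewrite addr_ge0 ?mulr_ge0 ?exprn_ge0 ?sqrtr_ge0.
rewrite exprMn; apply: ler_wpM2l; first by rewrite exprn_ge0.
by rewrite ler_weXn2l.
Qed.

(** The part [w <> 0] is interpolated between first and fourth moments, with [K ^ 4] from the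
    squared first moment. The part [w = 0] gives [K ^ 6], dominated by the term [K ^ 3] of [Q].
    Stated as a cube to avoid fractional powers. *)
Lemma energy_cube_le : (\sum_w (rep A w)%:R ^+ 2) ^+ 3 <= Lam ^+ 9 * (K%:R ^+ 4 * Q).
Proof.
have L := loss_ge.
rewrite energy_split; set x := _ ^+ 2; set y := \sum_(w | _) _.
have x0 : 0 <= x by apply: sqr_ge0.
have y0 : 0 <= y by apply: sumr_ge0 => w _; apply: sqr_ge0.
have hx : x ^+ 3 <= (2 * K%:R) ^+ 6.
  by rewrite /x -exprM; apply: lerXn2r; rewrite ?nnegrE ?mulr_ge0.
have hy : y ^+ 3 <= (4 * K%:R ^+ 2) ^+ 2 * (Lam ^+ 7 * Q).
  apply: le_trans (sum_sqr_interpolation _) _; first by [].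
  apply: ler_pM; rewrite ?sqr_ge0 ?fourth_moment_le //.
    by apply: sumr_ge0 => w _; rewrite exprn_ge0.
  apply: lerXn2r sum_rep_le; rewrite nnegrE; first exact: sumr_ge0.
  by apply: mulr_ge0; [exact: ler0n | exact: sqr_ge0].
(* The difference of the two sides is [3 (x + y) (x - y)^2]. *)
have cube : (x + y) ^+ 3 <= 4 * (x ^+ 3 + y ^+ 3).
  have : 0 <= 3 * (x + y) * (x - y) ^+ 2 by rewrite mulr_ge0 ?sqr_ge0 // mulr_ge0 // addr_ge0.
  lra.
have Q0 : 0 <= Q by rewrite addr_ge0 ?mulr_ge0 ?exprn_ge0 ?sqrtr_ge0.
have KQ : K%:R ^+ 6 <= K%:R ^+ 4 * Q.
  rewrite (exprD _ 4 2) ler_wpM2l ?exprn_ge0 //.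
  apply: (@le_trans _ _ (K%:R ^+ 3)); first by rewrite ler_weXn2l.
  by rewrite lerDr mulr_ge0 ?exprn_ge0 ?sqrtr_ge0.
have KQ0 : 0 <= K%:R ^+ 4 * Q by rewrite mulr_ge0 ?exprn_ge0.
have L7 : 1 <= Lam ^+ 7 by rewrite exprn_ege1 //; lra.
(* [320 = 4 * (64 + 16)], the constants of [cube], [hx] and [hy]. *)
have L97 : 320 * Lam ^+ 7 <= Lam ^+ 9.
  rewrite (exprD _ 7 2) mulrC ler_wpM2l //; first by lra.
  by nra.
have e1 := ler_wpM2r KQ0 L97.
have e2 := ler_wpM2r KQ0 L7.
have e3 : (2 * K%:R) ^+ 6 = 64 * K%:R ^+ 6 :> R by ring.
have e4 : (4 * K%:R ^+ 2) ^+ 2 * (Lam ^+ 7 * Q) = 16 * (Lam ^+ 7 * (K%:R ^+ 4 * Q)) by ring.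
rewrite e3 in hx; rewrite e4 in hy; apply: le_trans cube _.
move: (K%:R ^+ 4 * Q) (K%:R ^+ 6) (Lam ^+ 7) (Lam ^+ 9) (x ^+ 3) (y ^+ 3) hx hy e1 e2 KQ {KQ0 L7 L97 Q0}.
by move=> P K6 l7 l9 x3 y3; lra.
Qed.

End OneSet.

Lemma sum_sqrt_set_le (b : F) K (G : nat -> R) : b != 0 -> (2 * K <= q)%N ->
    (forall m, 0 <= G m) ->
  \sum_(u in sqrt_set b K) G (sqrt_index b u) <= 2 * \sum_(K <= m < 2 * K) G m.
Proof.
move=> b0 Kq G0; rewrite (sum_sqrt_set q_pr (fun m _ => G m) b0 Kq) mulr_sumr.
apply: ler_sum => m _; rewrite sumr_const -[leLHS]mulr_natl ler_wpM2r //.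
by rewrite ler_nat; exact: nsqrt_le2.
Qed.

Lemma normInf_ge K (beta : nat -> R[i]) k : (K <= k < 2 * K)%N ->
  cabs (beta k) <= normInf K beta.
Proof.
move=> Kk; rewrite /normInf.
have : k \in index_iota K (2 * K) by rewrite mem_index_iota.
elim: (index_iota _ _) => [//|x s IH]; rewrite inE big_cons => /orP[/eqP <-|/IH h].
  by rewrite le_max lexx.
by rewrite le_max h orbT.
Qed.

Variables (a h M N : nat) (alpha beta : nat -> R[i]).
Hypotheses (a_bd : (0 < a < q)%N) (h_bd : (0 < h < q)%N).
Hypotheses (M0 : (0 < M)%N) (N0 : (0 < N)%N) (Mq : (2 * M <= q)%N) (Nq : (2 * N <= q)%N).
Local Notation A2 := (\sum_(M <= m < 2 * M) cabs (alpha m) ^+ 2).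
Local Notation B1 := (\sum_(N <= n < 2 * N) cabs (beta n)).
Local Notation BI := (normInf N beta).
Local Notation X K := (K%:R ^+ 2 / q%:R + Num.sqrt K%:R : R).
Local Notation Q K := (K%:R ^+ 2 * Num.sqrt (K%:R ^+ 3 / q%:R) ^+ 3 + K%:R ^+ 3 : R).

Lemma Wsum_bound : exists2 off, 0 <= off &
  [/\ cabs (Wsum q a h M N alpha beta) ^+ 2 <= 2 * A2 * (4 * (M%:R * BI * B1) + off),
      off ^+ 4 <= (2 * B1) ^+ 6 * BI ^+ 2 *
        (Lam ^+ 3 * X N * (q%:R * (Lam ^+ 4 * (M%:R ^+ 2 * X M)))) &
      off ^+ 12 <= (2 * B1) ^+ 16 * BI ^+ 8 *
        (Lam ^+ 7 * Q N * (q%:R ^+ 3 * (Lam ^+ 9 * (M%:R ^+ 4 * Q M))))].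
Proof.
have [g g0 Wg] := Wsum_Wpart q_pr q_odd alpha beta a_bd h_bd Mq Nq M0.
(* The class with the larger part suffices, since [2 W] is the sum of the two. *)
have [j j0 Wj] : exists2 j : F, j != 0 &
    cabs (Wsum q a h M N alpha beta) <= cabs (Wpart a h M N alpha beta j).
  have : cabs (Wsum q a h M N alpha beta *+ 2) <=
      cabs (Wpart a h M N alpha beta (1 : F)) + cabs (Wpart a h M N alpha beta g).
    by rewrite Wg cabsD.
  rewrite -mulr_natl cabsM -(rmorph_nat (real_complex R)) cabs_real // => H.
  have [h1|h1] := leP (cabs (Wsum q a h M N alpha beta))
    (cabs (Wpart a h M N alpha beta (1 : F))).
    by exists 1 => //; apply: oner_neq0.
  by exists g => //; lra.
have a0 : a%:R != 0 :> F by apply: (Fp_nat_neq0 q_pr).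
have h0 : h%:R != 0 :> F by apply: (Fp_nat_neq0 q_pr).
have ja0 : j * a%:R != 0 by rewrite mulf_neq0.
have hj0 : h%:R / j != 0 by rewrite mulf_neq0 ?invr_eq0.
have bib v : v \in sqrt_set j N -> cabs (beta (sqrt_index j v)) <= BI.
  by rewrite inE => /normInf_ge.
have BI0 : 0 <= BI.
  by apply: le_trans (cabs_ge0 (beta N)) (normInf_ge _ _); rewrite leqnn ltn_Pmull.
have B10 : 0 <= B1 by apply: sumr_ge0 => n _; apply: cabs_ge0.
have [off off0 [H1 H2 H3]] := @bilinear_bound R q q_pr (sqrt_set (j * a%:R) M) (sqrt_set j N)
  (fun u => alpha (sqrt_index (j * a%:R) u)) (fun v => beta (sqrt_index j v)) _ BI hj0 bib
  _ (fun w w0 => rep_le j0 N0 w0).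
have hA2 := sum_sqrt_set_le ja0 Mq (fun m => sqr_ge0 (cabs (alpha m))).
have hB1 := sum_sqrt_set_le j0 Nq (fun n => cabs_ge0 (beta n)).
have hB10 : 0 <= \sum_(v in sqrt_set j N) cabs (beta (sqrt_index j v)).
  by apply: sumr_ge0 => v _; apply: cabs_ge0.
set b1 := \sum_(v in sqrt_set j N) _ in H1 H2 H3 hB1 hB10.
have X0 K : 0 <= X K by rewrite addr_ge0 ?sqrtr_ge0 // divr_ge0 ?sqr_ge0.
have Q0 K : 0 <= Q K by rewrite addr_ge0 ?mulr_ge0 ?exprn_ge0 ?sqrtr_ge0.
have E0 : 0 <= \sum_w (rep (sqrt_set (j * a%:R) M) w)%:R ^+ 2 :> R.
  by apply: sumr_ge0 => w _; apply: sqr_ge0.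
have BIn n : 0 <= BI ^+ n by rewrite exprn_ge0.
have b1n n : b1 ^+ n <= (2 * B1) ^+ n by apply: lerXn2r; rewrite ?nnegrE ?mulr_ge0.
have b1n0 n : 0 <= b1 ^+ n by rewrite exprn_ge0.
exists off => //; split.
- have W2 : cabs (Wsum q a h M N alpha beta) ^+ 2 <= cabs (Wpart a h M N alpha beta j) ^+ 2.
    by apply: lerXn2r; rewrite ?nnegrE ?cabs_ge0.
  apply: le_trans W2 (le_trans H1 _); apply: ler_pM => //.
  + by apply: sumr_ge0 => u _; apply: sqr_ge0.
  + by rewrite addr_ge0 // !mulr_ge0.
  rewrite lerD2r (_ : 4 * _ = (2 * M%:R) * BI * (2 * B1)); last by ring.
  apply: ler_pM => //; first by rewrite mulr_ge0.
  by rewrite ler_wpM2r // -natrM ler_nat card_sqrt_set.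
- apply: le_trans H2 _; apply: ler_pM.
  + exact: mulr_ge0.
  + apply: mulr_ge0; last exact: mulr_ge0.
    by apply: mulr_ge0; [exact: exprn_ge0 | exact: X0].
  + exact: ler_wpM2r.
  apply: ler_wpM2l; first by apply: mulr_ge0; [exact: exprn_ge0 | exact: X0].
  by apply: ler_wpM2l => //; exact: energy_le.
apply: le_trans H3 _; apply: ler_pM.
- exact: mulr_ge0.
- apply: mulr_ge0; last by apply: exprn_ge0; exact: mulr_ge0.
  by apply: sumr_ge0 => w _; apply: exprn_ge0.
- exact: ler_wpM2r.
rewrite exprMn; apply: ler_pM.
- by apply: sumr_ge0 => w _; apply: exprn_ge0.
- by apply: mulr_ge0; apply: exprn_ge0.
- exact: fourth_moment_le.
by apply: ler_wpM2l; [apply: exprn_ge0 | apply: energy_cube_le].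
Qed.

End EnergyBounds.

(** * The loss factor *)

(** Each dyadic block contributes at most 1. *)
Lemma harm_sum_pow2 (R : realType) a : harm_sum R (2 ^ a) <= a%:R.
Proof.
elim: a => [|a IH]; first by rewrite /harm_sum big_geq.
have le2 : (2 ^ a <= 2 ^ a.+1)%N by rewrite leq_exp2l.
rewrite /harm_sum (big_cat_nat (n := 2 ^ a)) //=; last by rewrite expn_gt0.
rewrite -natr1; apply: lerD; first exact: IH.
apply: (@le_trans _ _ (\sum_(2 ^ a <= j < 2 ^ a.+1) (2 ^ a)%:R^-1)).
  apply: ler_sum_nat => j /andP[aj _].
  by rewrite lef_pV2 ?posrE ?ltr0n ?expn_gt0 ?ler_nat // (leq_trans _ aj) ?expn_gt0.
rewrite sumr_const_nat expnS mul2n -addnn addnK -[_ *+ _]mulr_natr mulVf //.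
Qed.

Lemma harm_sum_power (R : realType) k n : (0 < k)%N -> (0 < n)%N ->
  harm_sum R n ^+ k <= (k ^ k * n)%:R.
Proof.
move=> k0 n0; set a := trunc_log 2 n.
have h0 m : 0 <= harm_sum R m by apply: sumr_ge0 => i _; rewrite invr_ge0.
have h : harm_sum R n <= a.+1%:R.
  apply: le_trans (harm_sum_pow2 R a.+1); apply: harm_sum_le.
  by apply: ltnW; apply: trunc_log_ltn.
apply: (@le_trans _ _ (a.+1%:R ^+ k)).
  by apply: lerXn2r; rewrite ?nnegrE.
rewrite -natrX ler_nat; apply: leq_trans (expn_succ_le a k0) _.
by rewrite leq_mul2l trunc_logP ?orbT.
Qed.

(** The floor 100 lets the loss absorb constants for every [q], not only for large ones. *)
Definition max_divisors (q : nat) : nat :=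
  maxn 100 (\max_(z < q ^ 2 | (0 < z)%N) size (divisors z)).

Lemma max_divisors_ge q : (100 <= max_divisors q)%N.
Proof. exact: leq_maxl. Qed.

Lemma max_divisorsP q z : (0 < z < q ^ 2)%N -> (size (divisors z) <= max_divisors q)%N.
Proof.
move=> /andP[z0 zq]; apply: leq_trans (leq_maxr _ _).
exact: (leq_bigmax_cond (F := fun z : 'I_(q ^ 2) => size (divisors z)) (Ordinal zq)).
Qed.

Lemma max_divisors_power k : (0 < k)%N -> exists2 C, (0 < C)%N &
  forall q, (0 < q)%N -> (max_divisors q ^ k <= C * q ^ 2)%N.
Proof.
move=> k0; have [C C0 HC] := divisor_bound k.
exists (100 ^ k + C)%N; first by rewrite addn_gt0 C0 orbT.
move=> q q0; have q20 : (0 < q ^ 2)%N by rewrite expn_gt0 q0.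
rewrite /max_divisors /maxn; case: ifP => _; last first.
  by rewrite mulnDl; apply: leq_trans (leq_addr _ _); rewrite leq_pmulr.
rewrite mulnDl; apply: leq_trans (leq_addl _ _).
apply: (big_ind (fun x => x ^ k <= C * q ^ 2)%N).
- by rewrite exp0n.
- by move=> x y hx hy; rewrite /maxn; case: ifP.
move=> z z0; apply: leq_trans (HC _ z0) _.
by rewrite leq_mul2l (ltnW (ltn_ord z)) orbT.
Qed.

Definition total_loss (R : realType) (q : nat) : R := loss R q (max_divisors q).

Lemma total_loss_power (R : realType) k : (0 < k)%N -> exists2 C : R, 1 <= C &
  forall q, (0 < q)%N -> total_loss R q ^+ k <= C * q%:R ^+ 4.
Proof.
move=> k0; have [C C0 HC] := max_divisors_power k0.
exists (C * k ^ k)%:R; first by rewrite ler1n muln_gt0 C0 expn_gt0 k0.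
move=> q q0; rewrite /total_loss /loss exprMn.
have h0 m : 0 <= harm_sum R m by apply: sumr_ge0 => i _; rewrite invr_ge0.
rewrite (_ : _%:R * _ ^+ 4 = (C * q ^ 2)%:R * (k ^ k * q ^ 2)%:R); last first.
  by rewrite !natrM !natrX; ring.
apply: ler_pM.
- by rewrite exprn_ge0.
- by rewrite exprn_ge0.
- by rewrite -natrX ler_nat HC.
by apply: harm_sum_power => //; rewrite expn_gt0 q0.
Qed.

(** The exponent for which [q] raised to it is the square of the loss, the power arising in the
    final bounds. *)
Definition exponent_loss (R : realType) (q : nat) : R := 2 * ln (total_loss R q) / ln q%:R.

Lemma total_loss_ge (R : realType) q : prime q -> 100 <= total_loss R q.
Proof. by move=> q_pr; apply: loss_ge => //; apply: max_divisors_ge. Qed.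

Lemma exponent_loss_cvg (R : realType) :
  (exponent_loss R n @[n --> \oo] --> (0 : R))%classic.
Proof.
apply/cvgrPdist_le => eps eps0.
(* From [L ^ k <= C q^4], the exponent is at most [8 / k + 2 ln C / (k ln q)]; this [k] makes the
   first term at most [eps / 2], and [qbig] does so for the second. *)
pose k := (Num.truncn (16 / eps)).+1.
have kR : 16 / eps <= k%:R.
  by rewrite ltW // truncnS_gt // divr_ge0 // ltW.
have [C C1 HC] := total_loss_power R (ltn0Sn _ : (0 < k)%N).
near=> q.
have q2 : (1 < q)%N by near: q; exact: nbhs_infty_gt.
have qbig : expR (4 * ln C / eps) <= q%:R by near: q; exact: nbhs_infty_ger.
have qR : 1 < q%:R :> R by rewrite ltr1n.
have lq0 : 0 < ln q%:R :> R by apply: ln_gt0.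
have q0 : 0 < q%:R :> R by lra.
have lC0 : 0 <= ln C by apply: ln_ge0.
have hs1 : 1 <= harm_sum R (q ^ 2).
  rewrite /harm_sum big_ltn; last by rewrite -[1%N]/(1 ^ 2)%N ltn_sqr.
  by rewrite invr1 lerDl; apply: sumr_ge0 => i _; rewrite invr_ge0.
have L1 : 1 <= total_loss R q.
  by rewrite mulr_ege1 // ler1n (leq_trans _ (max_divisors_ge q)).
have lL0 : 0 <= ln (total_loss R q) by apply: ln_ge0.
have L0 : 0 < total_loss R q by lra.
have lq : 4 * ln C / eps <= ln q%:R.
  by rewrite -[leLHS]expRK ler_ln ?posrE ?expR_gt0.
have main : k%:R * ln (total_loss R q) <= ln C + 4 * ln q%:R.
  have := HC q (ltnW q2).
  have C0 : 0 < C by lra.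
  have q40 : 0 < q%:R ^+ 4 :> R by rewrite exprn_gt0.
  rewrite -ler_ln; last 2 first.
  - by rewrite posrE exprn_gt0.
  - by rewrite posrE mulr_gt0.
  rewrite lnM ?posrE // !lnXn //.
  by rewrite -[ln _ *+ k]mulr_natl -[ln _ *+ 4]mulr_natl.
have kR0 : 0 < k%:R :> R by rewrite ltr0n.
rewrite ?(sub0r, subr0) ?normrN ger0_norm; last by rewrite divr_ge0 ?mulr_ge0 // ltW.
rewrite /exponent_loss ler_pdivrMr //.
rewrite -(ler_pM2l kR0).
have h1 : 16 <= k%:R * eps by rewrite -ler_pdivrMr.
have h2 : 4 * ln C <= eps * ln q%:R by move: lq; rewrite ler_pdivrMr // [ln q%:R * _]mulrC.
have h3 : 16 * ln q%:R <= k%:R * eps * ln q%:R by rewrite ler_wpM2r // ltW.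
have k1 : 1 <= k%:R :> R by rewrite ler1n.
have h4 : eps * ln q%:R <= k%:R * (eps * ln q%:R) by rewrite ler_peMl // mulr_ge0 // ltW.
lra.
Unshelve. all: by end_near.
Qed.

Lemma powR_exponent_loss (R : realType) q : prime q ->
  powR q%:R (exponent_loss R q) = total_loss R q ^+ 2.
Proof.
move=> q_pr; have L := total_loss_ge R q_pr.
have qR : 1 < q%:R :> R by rewrite ltr1n prime_gt1.
have lq0 : 0 < ln q%:R :> R by apply: ln_gt0.
rewrite /powR gt_eqF; last by lra.
rewrite /exponent_loss divfK ?gt_eqF // mulr_natl -lnXn; last by lra.
by rewrite lnK // posrE exprn_gt0 //; lra.
Qed.

(** * Assembling the estimates *)

Section RootArithmetic.
Variable R : realType.
Implicit Types x y L : R.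

Lemma powR_root n m x s : (0 < n)%N -> s = n%:R^-1 * m%:R -> powR x s = powR x n%:R^-1 ^+ m.
Proof. by move=> n0 ->; rewrite powRrM powR_mulrn // powR_ge0. Qed.

Lemma powR_rootK n x : (0 < n)%N -> 0 <= x -> powR x n%:R^-1 ^+ n = x.
Proof.
move=> n0 x0; rewrite -(@powR_root n n x 1) ?powRr1 // mulVf //.
by rewrite pnatr_eq0 -lt0n.
Qed.

(** Turns the sums [p^8 + 1] and [p^24 + 1] produced by the moments into powers of the factors
    [p + 1] of the theorem. *)
Lemma exprDn_ge (p : R) n : 0 <= p -> p ^+ n.+1 + 1 <= (p + 1) ^+ n.+1.
Proof.
move=> p0; elim: n => [|n IH]; first by rewrite !expr1.
rewrite exprS (exprS (p + 1)).
have pn : 0 <= p ^+ n.+1 by rewrite exprn_ge0.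
have := ler_wpM2l (_ : 0 <= p + 1) IH; rewrite addr_ge0 // => /(_ isT).
by apply: le_trans; rewrite mulrDr mulrDl mulr1 mul1r; lra.
Qed.

Variables (mu nu ka b1 bi L w off A : R).
Hypotheses (mu1 : 1 <= mu) (nu1 : 1 <= nu) (ka0 : 0 < ka) (muka : mu ^+ 3 <= ka).
Hypotheses (bi0 : 0 <= bi) (bib1 : bi <= b1) (L100 : 100 <= L).
Hypotheses (w0 : 0 <= w) (off0 : 0 <= off) (A0 : 0 <= A).
Hypothesis w_le : w ^+ 2 <= 2 * A * (4 * (mu ^+ 48 * bi ^+ 12 * b1 ^+ 12) + off).

Let mu0 : 0 <= mu. Proof. by apply: le_trans mu1. Qed.
Let nu0 : 0 <= nu. Proof. by apply: le_trans nu1. Qed.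
Let b10 : 0 <= b1. Proof. exact: le_trans bib1. Qed.
Let ka0' : 0 <= ka. Proof. exact: ltW. Qed.
Let L0 : 0 <= L. Proof. by apply: le_trans L100. Qed.

Let ratio_ge0 x m n : 0 <= x -> 0 <= x ^+ m / ka ^+ n.
Proof. by move=> x0; rewrite divr_ge0 ?exprn_ge0. Qed.

(** With both contributions controlled by [Z], [w ^+ 2 <= A (8 + 2 L^2) Z^2], and
    [8 + 2 L^2 <= L^4]. *)
Let conclude Z : 0 <= Z -> mu ^+ 48 * bi ^+ 12 * b1 ^+ 12 <= Z ^+ 2 ->
  off <= L ^+ 2 * Z ^+ 2 -> w <= Num.sqrt A * L ^+ 2 * Z.
Proof.
move=> Z0 dg of2.
rewrite -(@ler_pXn2r _ 2) ?nnegrE ?mulr_ge0 ?sqrtr_ge0 ?exprn_ge0 //.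
rewrite !exprMn sqr_sqrtr //; apply: le_trans w_le _.
rewrite [2 * A]mulrC -[leLHS]mulrA -[leRHS]mulrA; apply: ler_wpM2l => //.
have Z2 := sqr_ge0 Z.
have L1 : 1 <= L by apply: le_trans L100; rewrite (ler_nat R 1).
have L2 : 100 <= L ^+ 2 by apply: (le_trans L100); rewrite expr2 ler_peMl.
have : 10 * (L ^+ 2 * Z ^+ 2) <= (L ^+ 2) ^+ 2 * Z ^+ 2.
  rewrite [(L ^+ 2) ^+ 2]expr2 mulrA; apply: ler_wpM2r => //; apply: ler_wpM2r; first exact: sqr_ge0.
  by apply: le_trans L2; rewrite ler_nat.
have : 100 * Z ^+ 2 <= L ^+ 2 * Z ^+ 2 by apply: ler_wpM2r.
by lra.
Qed.

(** The diagonal has equal powers of the two norms of beta; the sup norm being the smaller, part of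
    it may be traded for the other. *)
Let diag_b m : (m <= 12)%N -> bi ^+ 12 * b1 ^+ 12 <= bi ^+ (12 - m) * b1 ^+ (12 + m).
Proof.
move=> m12.
have h : bi ^+ m <= b1 ^+ m by apply: lerXn2r; rewrite ?nnegrE.
have -> : bi ^+ 12 = bi ^+ (12 - m) * bi ^+ m by rewrite -exprD subnK.
rewrite (exprD b1) mulrAC mulrA; apply: ler_wpM2l h.
by rewrite mulr_ge0 ?exprn_ge0.
Qed.

(** Both [X] factors become [x^24 (p^8 + 1)] with [p = x^9 / ka^2], and [64 L^7 <= L^8]. The
    diagonal is covered by the [p ^+ 2] part of [Z ^+ 2]. *)
Lemma root_bound2 :
  off ^+ 4 <= (2 * b1 ^+ 12) ^+ 6 * (bi ^+ 12) ^+ 2 *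
    (L ^+ 3 * (nu ^+ 96 / ka ^+ 16 + nu ^+ 24) *
      (ka ^+ 16 * (L ^+ 4 * (mu ^+ 96 * (mu ^+ 96 / ka ^+ 16 + mu ^+ 24))))) ->
  w <= Num.sqrt A * L ^+ 2 * (b1 ^+ 9 * bi ^+ 3 * ka ^+ 2 * mu ^+ 15 * nu ^+ 3 *
    (mu ^+ 9 / ka ^+ 2 + 1) * (nu ^+ 9 / ka ^+ 2 + 1)).
Proof.
move=> hoff; set p := mu ^+ 9 / _; set r := nu ^+ 9 / _.
have p0 : 0 <= p by apply: ratio_ge0.
have r0 : 0 <= r by apply: ratio_ge0.
set Z := _ * (r + 1).
have Z0 : 0 <= Z by rewrite !mulr_ge0 ?exprn_ge0 // addr_ge0.
have kaN : ka != 0 by rewrite gt_eqF.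
apply: conclude => //.
  have e : b1 ^+ 18 * bi ^+ 6 * mu ^+ 48 = b1 ^+ 18 * bi ^+ 6 * (ka ^+ 4 * mu ^+ 30) * p ^+ 2.
    by rewrite /p; field.
  apply: (@le_trans _ _ (b1 ^+ 18 * bi ^+ 6 * mu ^+ 48)).
    rewrite -mulrA mulrC [b1 ^+ 18 * _]mulrC ler_wpM2r ?exprn_ge0 //.
    exact: (@diag_b 6).
  rewrite e (_ : Z ^+ 2 = b1 ^+ 18 * bi ^+ 6 * (ka ^+ 4 * mu ^+ 30) *
      (nu ^+ 6 * (p + 1) ^+ 2 * (r + 1) ^+ 2)); last by rewrite /Z; ring.
  apply: ler_wpM2l; first by rewrite !mulr_ge0 ?exprn_ge0.
  have h1 : p ^+ 2 <= (p + 1) ^+ 2 by apply: lerXn2r; rewrite ?nnegrE ?addr_ge0 // lerDl.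
  have h2 : 1 <= nu ^+ 6 by rewrite exprn_ege1.
  have h3 : 1 <= (r + 1) ^+ 2 by rewrite exprn_ege1 // lerDr.
  apply: (le_trans h1); rewrite [nu ^+ 6 * _]mulrC -mulrA ler_peMr ?sqr_ge0 //.
  by rewrite mulr_ege1.
have LZ : 0 <= L ^+ 2 * Z ^+ 2 by apply: mulr_ge0; apply: sqr_ge0.
rewrite -(@ler_pXn2r _ 4) ?nnegrE //.
apply: le_trans hoff _.
pose P := b1 ^+ 72 * bi ^+ 24 * ka ^+ 16 * mu ^+ 120 * nu ^+ 24.
have P0 : 0 <= P by rewrite !mulr_ge0 ?exprn_ge0.
rewrite [leLHS](_ : _ = (64 * L ^+ 7) * (P * ((p ^+ 8 + 1) * (r ^+ 8 + 1)))); last first.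
  by rewrite /P /p /r; field.
rewrite [leRHS](_ : _ = L ^+ 8 * (P * ((p + 1) ^+ 8 * (r + 1) ^+ 8))); last first.
  by rewrite /P /Z; ring.
have p80 : 0 <= p ^+ 8 by rewrite exprn_ge0.
have r80 : 0 <= r ^+ 8 by rewrite exprn_ge0.
apply: ler_pM.
- by rewrite mulr_ge0 ?exprn_ge0.
- by rewrite !mulr_ge0 // addr_ge0.
- by rewrite (exprS L 7); apply: ler_wpM2r; [rewrite exprn_ge0 | apply: le_trans L100; rewrite ler_nat].
apply: ler_wpM2l => //; apply: ler_pM; [by rewrite addr_ge0|by rewrite addr_ge0| |]; exact: exprDn_ge.
Qed.

(** Both [Q] factors become [x^144 (p^24 + 1)] with [p = x^7 / ka], and [2^16 L^16 <= L^24]. *)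
Lemma root_bound1 :
  off ^+ 12 <= (2 * b1 ^+ 12) ^+ 16 * (bi ^+ 12) ^+ 8 *
    (L ^+ 7 * (nu ^+ 96 * (nu ^+ 72 / ka ^+ 8) ^+ 3 + nu ^+ 144) *
      (ka ^+ 48 * (L ^+ 9 * (mu ^+ 192 * (mu ^+ 96 * (mu ^+ 72 / ka ^+ 8) ^+ 3 + mu ^+ 144))))) ->
  w <= Num.sqrt A * L ^+ 2 * (bi ^+ 4 * b1 ^+ 8 * ka ^+ 2 * mu ^+ 14 * nu ^+ 6 *
    (mu ^+ 7 / ka + 1) * (nu ^+ 7 / ka + 1)).
Proof.
move=> hoff; set p := mu ^+ 7 / _; set r := nu ^+ 7 / _.
have p0 : 0 <= p by have := @ratio_ge0 mu 7 1 mu0; rewrite expr1.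
have r0 : 0 <= r by have := @ratio_ge0 nu 7 1 nu0; rewrite expr1.
set Z := _ * (r + 1).
have Z0 : 0 <= Z by rewrite !mulr_ge0 ?exprn_ge0 // addr_ge0.
have kaN : ka != 0 by rewrite gt_eqF.
apply: conclude => //.
  have e : b1 ^+ 16 * bi ^+ 8 * (ka ^+ 2 * mu ^+ 42) =
      b1 ^+ 16 * bi ^+ 8 * (ka ^+ 4 * mu ^+ 28) * p ^+ 2.
    by rewrite /p; field.
  apply: (@le_trans _ _ (b1 ^+ 16 * bi ^+ 8 * (ka ^+ 2 * mu ^+ 42))).
    rewrite -mulrA mulrC; apply: ler_pM; rewrite ?mulr_ge0 ?exprn_ge0 //.
      by rewrite [b1 ^+ 16 * _]mulrC; exact: (@diag_b 4).
    (* The diagonal exceeds the target shape by [mu^6 / ka^2], at most 1 because [M <= q]. *)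
    rewrite (exprD mu 6 42) ler_wpM2r ?exprn_ge0 // (exprM mu 3 2).
    by apply: lerXn2r; rewrite ?nnegrE ?exprn_ge0.
  rewrite e (_ : Z ^+ 2 = b1 ^+ 16 * bi ^+ 8 * (ka ^+ 4 * mu ^+ 28) *
      (nu ^+ 12 * (p + 1) ^+ 2 * (r + 1) ^+ 2)); last by rewrite /Z; ring.
  apply: ler_wpM2l; first by rewrite !mulr_ge0 ?exprn_ge0.
  have h1 : p ^+ 2 <= (p + 1) ^+ 2 by apply: lerXn2r; rewrite ?nnegrE ?addr_ge0 // lerDl.
  have h2 : 1 <= nu ^+ 12 by rewrite exprn_ege1.
  have h3 : 1 <= (r + 1) ^+ 2 by rewrite exprn_ege1 // lerDr.
  apply: (le_trans h1); rewrite [nu ^+ 12 * _]mulrC -mulrA ler_peMr ?sqr_ge0 //.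
  by rewrite mulr_ege1.
have LZ : 0 <= L ^+ 2 * Z ^+ 2 by apply: mulr_ge0; apply: sqr_ge0.
rewrite -(@ler_pXn2r _ 12) ?nnegrE //.
apply: le_trans hoff _.
pose P := b1 ^+ 192 * bi ^+ 96 * ka ^+ 48 * mu ^+ 336 * nu ^+ 144.
have P0 : 0 <= P by rewrite !mulr_ge0 ?exprn_ge0.
rewrite [leLHS](_ : _ = (2 ^+ 16 * L ^+ 16) * (P * ((p ^+ 24 + 1) * (r ^+ 24 + 1)))); last first.
  by rewrite /P /p /r; field.
rewrite [leRHS](_ : _ = L ^+ 24 * (P * ((p + 1) ^+ 24 * (r + 1) ^+ 24))); last first.
  by rewrite /P /Z; ring.
have p80 : 0 <= p ^+ 24 by rewrite exprn_ge0.
have r80 : 0 <= r ^+ 24 by rewrite exprn_ge0.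
apply: ler_pM.
- by rewrite mulr_ge0 ?exprn_ge0.
- by rewrite !mulr_ge0 // addr_ge0.
- rewrite (exprD L 8 16); apply: ler_wpM2r; first by rewrite exprn_ge0.
  rewrite (exprM 2 2 8); apply: lerXn2r; rewrite ?nnegrE ?exprn_ge0 //.
  by rewrite -natrX; apply: le_trans L100; rewrite ler_nat.
apply: ler_wpM2l => //; apply: ler_pM; [by rewrite addr_ge0|by rewrite addr_ge0| |]; exact: exprDn_ge.
Qed.

End RootArithmetic.

Lemma Wsum_bound_two (R : realType) (a h : nat) (alpha beta : nat -> R[i]) :
  cabs (Wsum 2 a h 1 1 alpha beta) ^+ 2 <=
  8 * (cabs (alpha 1%N) ^+ 2 * (cabs (beta 1%N) * cabs (beta 1%N))).
Proof.
rewrite /Wsum !big_nat1 !cabsM !exprMn.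
have hs : cabs (\sum_(x < 2 | (x ^ 2 == a * 1 * 1 %[mod 2])%N) eq_add R 2 (h * x)) <= 2.
  apply: le_trans (cabs_sum _ _ _) _; rewrite (eq_bigr (fun=> 1)) => [|x _].
    by rewrite sumr_const ler_nat (leq_trans (max_card _)) // card_ord.
  exact: cabs_eq_add.
have s0 := cabs_ge0 (\sum_(x < 2 | (x ^ 2 == a * 1 * 1 %[mod 2])%N) eq_add R 2 (h * x)).
have hs2 := ler_pM s0 s0 hs hs; rewrite -expr2 in hs2.
have ab0 : 0 <= cabs (alpha 1%N) ^+ 2 * cabs (beta 1%N) ^+ 2 by rewrite mulr_ge0 ?sqr_ge0.
by have := ler_wpM2l ab0 hs2; rewrite -[cabs (beta 1%N) * _]expr2; lra.
Qed.

(** * From the polynomial inequalities back to norms and real powers *)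

Section Assembly.
Variables (R : realType) (q a h M N : nat) (alpha beta : nat -> R[i]).
Hypotheses (q_pr : prime q) (a_bd : (0 < a < q)%N) (h_bd : (0 < h < q)%N).
Hypotheses (M0 : (0 < M)%N) (N0 : (0 < N)%N) (Mq : (2 * M <= q)%N) (Nq : (2 * N <= q)%N).
Local Notation A2 := (\sum_(M <= m < 2 * M) cabs (alpha m) ^+ 2).
Local Notation B1 := (\sum_(N <= n < 2 * N) cabs (beta n)).
Local Notation BI := (normInf N beta).
Local Notation Lam := (total_loss R q).
Local Notation X K := (K%:R ^+ 2 / q%:R + Num.sqrt K%:R : R).
Local Notation Q K := (K%:R ^+ 2 * Num.sqrt (K%:R ^+ 3 / q%:R) ^+ 3 + K%:R ^+ 3 : R).

Let Lam0 : 0 <= Lam. Proof. by apply: le_trans (total_loss_ge R q_pr). Qed.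

Lemma Wsum_bound_all : exists2 off, 0 <= off &
  [/\ cabs (Wsum q a h M N alpha beta) ^+ 2 <= 2 * A2 * (4 * (M%:R * BI * B1) + off),
      off ^+ 4 <= (2 * B1) ^+ 6 * BI ^+ 2 *
        (Lam ^+ 3 * X N * (q%:R * (Lam ^+ 4 * (M%:R ^+ 2 * X M)))) &
      off ^+ 12 <= (2 * B1) ^+ 16 * BI ^+ 8 *
        (Lam ^+ 7 * Q N * (q%:R ^+ 3 * (Lam ^+ 9 * (M%:R ^+ 4 * Q M))))].
Proof.
have [q_odd|q_even] := boolP (odd q).
  exact: (Wsum_bound q_pr q_odd (@max_divisorsP q) (max_divisors_ge q) alpha beta a_bd h_bd M0 N0 Mq Nq).
(* In characteristic 2 every element is a square and the class argument fails; but then [M = N = 1],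
   and the single term is trivially bounded with [off = 0]. *)
have q2 : q = 2%N by case: (even_prime q_pr) => // q_odd; rewrite q_odd in q_even.
have one K : (0 < K)%N -> (2 * K <= q)%N -> K = 1%N.
  by rewrite q2 (leq_pmul2l (n2 := 1)) //; case: K => [|[|K]].
have M1 : M = 1%N by apply: one.
have N1 : N = 1%N by apply: one.
have BI0 : 0 <= BI.
  by apply: le_trans (cabs_ge0 (beta N)) (normInf_ge _ _); rewrite leqnn ltn_Pmull.
have B10 : 0 <= B1 by apply: sumr_ge0 => n _; apply: cabs_ge0.
have X0 K : 0 <= X K by rewrite addr_ge0 ?sqrtr_ge0 // divr_ge0 ?sqr_ge0.
have Q0 K : 0 <= Q K by rewrite addr_ge0 ?mulr_ge0 ?exprn_ge0 ?sqrtr_ge0.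
exists 0 => //; split.
- have := @Wsum_bound_two R a h alpha beta.
  have : BI = cabs (beta 1%N) by rewrite N1 /normInf big_ltn // big_geq // max_l // cabs_ge0.
  by rewrite q2 M1 N1 !muln1 !big_nat1 => ->; lra.
- rewrite expr0n; apply: mulr_ge0; first by apply: mulr_ge0; apply: exprn_ge0 => //; apply: mulr_ge0.
  apply: mulr_ge0; first by apply: mulr_ge0; [apply: exprn_ge0 | apply: X0].
  apply: mulr_ge0 => //; apply: mulr_ge0; first exact: exprn_ge0.
  by apply: mulr_ge0; [apply: exprn_ge0 | apply: X0].
rewrite expr0n; apply: mulr_ge0; first by apply: mulr_ge0; apply: exprn_ge0 => //; apply: mulr_ge0.
apply: mulr_ge0; first by apply: mulr_ge0; [apply: exprn_ge0 | apply: Q0].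
apply: mulr_ge0; first exact: exprn_ge0.
apply: mulr_ge0; first exact: exprn_ge0.
by apply: mulr_ge0; [apply: exprn_ge0 | apply: Q0].
Qed.

Lemma normL2E : normL 2 M alpha = Num.sqrt A2.
Proof.
rewrite /normL powR12_sqrt; last by apply: sumr_ge0 => m _; apply: powR_ge0.
by congr Num.sqrt; apply: eq_bigr => m _; rewrite powR_mulrn ?cabs_ge0.
Qed.

Lemma normL1E : normL 1 N beta = B1.
Proof.
rewrite /normL invr1 powRr1; last by apply: sumr_ge0 => m _; apply: powR_ge0.
by apply: eq_bigr => n _; rewrite powRr1 ?cabs_ge0.
Qed.

Lemma normInf_le_sum : BI <= B1.
Proof.
rewrite /normInf; elim: (index_iota _ _) => [|x s IH]; first by rewrite !big_nil.
rewrite !big_cons ge_max lerDl (le_trans IH) ?lerDr ?cabs_ge0 // andbT.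
by apply: sumr_ge0 => i _; apply: cabs_ge0.
Qed.

Lemma Wsum_le :
  cabs (Wsum q a h M N alpha beta) <=
    normL 2 M alpha * powR (normInf N beta) (1/3) * powR (normL 1 N beta) (2/3)
    * powR q%:R (1/8 + exponent_loss R q) * powR M%:R (7/24) * powR N%:R (1/8)
    * (powR M%:R (7/48) / powR q%:R (1/16) + 1)
    * (powR N%:R (7/48) / powR q%:R (1/16) + 1)
  /\
  cabs (Wsum q a h M N alpha beta) <=
    normL 2 M alpha * powR (normL 1 N beta) (3/4) * powR (normInf N beta) (1/4)
    * powR q%:R (1/8 + exponent_loss R q) * powR M%:R (5/16) * powR N%:R (1/16)
    * (powR M%:R (3/16) / powR q%:R (1/8) + 1)
    * (powR N%:R (3/16) / powR q%:R (1/8) + 1).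
Proof.
have [off off0 [H1 H2 H3]] := Wsum_bound_all.
have L100 := total_loss_ge R q_pr.
have qR0 : 0 < q%:R :> R by rewrite ltr0n prime_gt0.
have BI0 : 0 <= BI.
  by apply: le_trans (cabs_ge0 (beta N)) (normInf_ge _ _); rewrite leqnn ltn_Pmull.
have BIB1 := normInf_le_sum.
have B10 : 0 <= B1 := le_trans BI0 BIB1.
(* 48, 16 and 12 are common denominators for the exponents of [M] and [N], of [q], and of the norms
   of beta; in these roots all estimates are polynomial or rational. *)
pose mu : R := powR M%:R 48%:R^-1; pose nu : R := powR N%:R 48%:R^-1.
pose ka : R := powR q%:R 16%:R^-1.
pose b1 := powR B1 12%:R^-1; pose bi := powR BI 12%:R^-1.
have ME : M%:R = mu ^+ 48 by rewrite powR_rootK.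
have NE : N%:R = nu ^+ 48 by rewrite powR_rootK.
have qE : q%:R = ka ^+ 16 by rewrite powR_rootK // ltW.
have B1E : B1 = b1 ^+ 12 by rewrite powR_rootK.
have BIE : BI = bi ^+ 12 by rewrite powR_rootK.
have inv0 n : 0 <= n%:R^-1 :> R by rewrite invr_ge0.
have root_ge1 n K : (0 < K)%N -> 1 <= powR K%:R n%:R^-1 :> R.
  move=> K0; rewrite -[leLHS](powRr0 K%:R); apply: ler_powR; first by rewrite ler1n.
  exact: inv0.
have mu1 : 1 <= mu by apply: root_ge1.
have nu1 : 1 <= nu by apply: root_ge1.
have ka0 : 0 < ka by apply: powR_gt0.
have bi0 : 0 <= bi by apply: powR_ge0.
have bib1 : bi <= b1 by apply: ge0_ler_powR; rewrite ?nnegrE.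
have mu0 : 0 <= mu by apply: powR_ge0.
have nu0 : 0 <= nu by apply: powR_ge0.
have muka : mu ^+ 3 <= ka.
  rewrite -(@ler_pXn2r _ 16) ?nnegrE ?exprn_ge0 ?(ltW ka0) // -exprM -ME -qE ler_nat.
  by apply: leq_trans Mq; rewrite leq_pmull.
have A0 : 0 <= A2 by apply: sumr_ge0 => m _; apply: sqr_ge0.
have kaN : ka != 0 by rewrite gt_eqF.
have sqrtE K (x : R) : 0 <= x -> K%:R = x ^+ 48 -> Num.sqrt K%:R = x ^+ 24.
  by move=> x0 ->; rewrite (exprM x 24 2) sqrtr_sqr ger0_norm // exprn_ge0.
have sqrt3E K (x : R) : 0 <= x -> K%:R = x ^+ 48 -> Num.sqrt (K%:R ^+ 3 / q%:R) = x ^+ 72 / ka ^+ 8.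
  move=> x0 ->; rewrite qE (_ : _ / _ = (x ^+ 72 / ka ^+ 8) ^+ 2); last by field.
  by rewrite sqrtr_sqr ger0_norm // divr_ge0 ?exprn_ge0 // ltW.
rewrite (sqrtE N nu) // (sqrtE M mu) // in H2.
rewrite (sqrt3E N nu) // (sqrt3E M mu) // in H3.
rewrite ME BIE B1E in H1; rewrite ME NE qE BIE B1E in H2; rewrite ME NE qE BIE B1E in H3.
rewrite normL2E normL1E powRD; last by apply/implyP => _; rewrite gt_eqF.
rewrite powR_exponent_loss //.
rewrite (@powR_root _ 16 2 q%:R (1/8)) -/ka //; last by field.
rewrite (@powR_root _ 16 1 q%:R (1/16)) -/ka ?expr1 //; last by field.
rewrite (@powR_root _ 48 14 M%:R (7/24)) -/mu //; last by field.
rewrite (@powR_root _ 48 7 M%:R (7/48)) -/mu //; last by field.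
rewrite (@powR_root _ 48 15 M%:R (5/16)) -/mu //; last by field.
rewrite (@powR_root _ 48 9 M%:R (3/16)) -/mu //; last by field.
rewrite (@powR_root _ 48 6 N%:R (1/8)) -/nu //; last by field.
rewrite (@powR_root _ 48 7 N%:R (7/48)) -/nu //; last by field.
rewrite (@powR_root _ 48 3 N%:R (1/16)) -/nu //; last by field.
rewrite (@powR_root _ 48 9 N%:R (3/16)) -/nu //; last by field.
rewrite (@powR_root _ 12 4 BI (1/3)) -/bi //; last by field.
rewrite (@powR_root _ 12 3 BI (1/4)) -/bi //; last by field.
rewrite (@powR_root _ 12 8 B1 (2/3)) -/b1 //; last by field.
rewrite (@powR_root _ 12 9 B1 (3/4)) -/b1 //; last by field.
have w0 := cabs_ge0 (Wsum q a h M N alpha beta).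
split.
  have := root_bound1 mu1 nu1 ka0 muka bi0 bib1 L100 w0 off0 A0 H1; rewrite -!exprM in H3.
  move=> /(_ _) B; apply: le_trans (B _) _.
    by apply: le_trans H3 _; rewrite le_eqVlt; apply/orP; left; apply/eqP; ring.
  by rewrite le_eqVlt; apply/orP; left; apply/eqP; ring.
have B := root_bound2 mu1 nu1 ka0 bi0 bib1 L100 w0 off0 A0 H1.
apply: le_trans (B _) _; first by apply: le_trans H2 _; rewrite -!exprM.
by rewrite le_eqVlt; apply/orP; left; apply/eqP; ring.
Qed.

End Assembly.

Theorem theorem1p4 (R : realType) :
  exists f : nat -> R, (f n @[n --> \oo] --> (0 : R)) /\
  forall (q a h M N : nat) (alpha beta : nat -> R[i]),
    prime q -> (0 < a < q)%N -> (0 < h < q)%N ->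
    (0 < M)%N -> (0 < N)%N -> (2 * M <= q)%N -> (2 * N <= q)%N ->
    cabs (Wsum q a h M N alpha beta) <=
      normL 2 M alpha * powR (normInf N beta) (1/3) * powR (normL 1 N beta) (2/3)
      * powR q%:R (1/8 + f q) * powR M%:R (7/24) * powR N%:R (1/8)
      * (powR M%:R (7/48) / powR q%:R (1/16) + 1)
      * (powR N%:R (7/48) / powR q%:R (1/16) + 1)
    /\
    cabs (Wsum q a h M N alpha beta) <=
      normL 2 M alpha * powR (normL 1 N beta) (3/4) * powR (normInf N beta) (1/4)
      * powR q%:R (1/8 + f q) * powR M%:R (5/16) * powR N%:R (1/16)
      * (powR M%:R (3/16) / powR q%:R (1/8) + 1)
      * (powR N%:R (3/16) / powR q%:R (1/8) + 1).
Proof.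
exists (exponent_loss R); split; first exact: exponent_loss_cvg.
move=> q a h M N alpha beta q_pr a_bd h_bd M0 N0 Mq Nq.
exact: Wsum_le.
Qed.
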